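(* Let $\Gamma[X]=\Gamma[X(\cdot,t)]\subset\mathbb{R}^n$, $t\in[0,T]$, be a regular $m$-dimensional submanifold moving under mean curvature flow in codimension $n-m$, i.e. with velocity $v=\vec H$. Then the orthogonal projection $\pi$ onto the tangent space and the mean curvature vector $\vec H$ satisfy $$\partial^\bullet \pi = \Delta_{\Gamma[X]}\pi + f_1(\pi),\qquad \partial^\bullet \vec H = \Delta_{\Gamma[X]}\vec H + f_2(\pi,\vec H),$$ where the Laplace--Beltrami operator is understood componentwise and the non-linear terms are given componentwise, for $\alpha,\beta=1,\dots,n$, by $$f_1(\pi)_{\alpha\beta} = 2\sum_{\mu=1}^{n}\nabla_{\Gamma[X]}\pi_{\alpha\mu}\cdot\nabla_{\Gamma[X]}\pi_{\beta\mu} - 4\sum_{\mu,\kappa=1}^{n}\pi_{\mu\kappa}\,\nabla_{\Gamma[X]}\pi_{\alpha\mu}\cdot\nabla_{\Gamma[X]}\pi_{\beta\kappa},$$ $$f_2(\pi,\vec H)_{\alpha} = 2\sum_{\mu=1}^{n}\nabla_{\Gamma[X]}\pi_{\alpha\mu}\cdot\nabla_{\Gamma[X]}H_{\mu} + 4\sum_{\mu,\kappa=1}^{n}\nabla_{\Gamma[X]}\pi_{\alpha\mu}\cdot\nabla_{\Gamma[X]}\pi_{\mu\kappa}\,H_\kappa,$$ with $H_\mu$ denoting the $\mu$-th component of $\vec H\in\mathbb{R}^n$.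
   Context: Let $m\in\{1,2,3\}$ and $n-m\ge 1$. $\Gamma^0\subset\mathbb{R}^n$ is a smooth closed $m$-dimensional submanifold, $X:\Gamma^0\times[0,T]\to\mathbb{R}^n$ is smooth, $X(\cdot,t)$ is an embedding for every $t$, $X(p,0)=p$, and $\Gamma[X]=\Gamma[X(\cdot,t)]=\{X(p,t):p\in\Gamma^0\}$. The velocity $v$ is defined by $\partial_tX(p,t)=v(X(p,t),t)$. The material derivative of a function $u(x,t)$, $x\in\Gamma[X(\cdot,t)]$, is $\partial^\bullet u(x,t)=\frac{d}{dt}u(X(p,t),t)$ for $x=X(p,t)$. In local coordinates on $\Gamma^0$ (indices $i,j,k=1,\dots,m$; repeated Latin indices are summed), $g_{ij}=\partial_iX\cdot\partial_jX$ is the induced metric with inverse $(g^{ij})$ and Christoffel symbols $\Gamma_{ij}^k$; the second fundamental form is $A_{ij}=(\partial_i\partial_jX)^\perp=\partial_i\partial_jX-\Gamma_{ij}^k\partial_kX\in\mathbb{R}^n$, where $^\perp$ is the projection onto the orthogonal complement of the tangent space; the mean curvature vector is $\vec H=g^{ij}A_{ij}\in\mathbb{R}^n$ (for a sphere of radius $R$ it points inwards and has length $m/R$); and $\pi=g^{ij}\,\partial_iX\otimes\partial_jX\in\mathbb{R}^{n\times n}$ is the orthogonal projection from $\mathbb{R}^n$ onto the tangent space of $\Gamma[X(\cdot,t)]$ at $X(p,t)$. For scalar $u$, $\nabla_{\Gamma}u=g^{ij}\,\partial_iu\,\partial_jX\in\mathbb{R}^n$ is the tangential gradient, $\cdot$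 is the Euclidean product, and $\Delta_\Gamma u=\nabla_\Gamma\cdot\nabla_\Gamma u$ is the Laplace--Beltrami operator. *)

(* Defs.v *)
From mathcomp Require Import all_boot all_order all_algebra.
From mathcomp Require Import all_classical all_reals all_analysis.

Set Implicit Arguments.
Unset Strict Implicit.
Unset Printing Implicit Defensive.

Import Order.TTheory GRing.Theory Num.Theory.
Import numFieldNormedType.Exports.

Local Open Scope classical_set_scope.
Local Open Scope ring_scope.

Section Smoothness.
Context {R : realType} {V W : normedModType R}.

(* Only used for finite-dimensional V, where quantifying over all directions v
   is the same as quantifying over the partial derivatives. *)
Fixpoint Ck (k : nat) (U : set V) (f : V -> W) : Prop :=
  if k is k'.+1 then
    (forall x, U x -> differentiable f x) /\ (forall v, Ck k' U ('D_v f))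
  else forall x, U x -> {for x, continuous f}.

Definition smooth_open (U : set V) (f : V -> W) : Prop := forall k, Ck k U f.

(* Smoothness on an arbitrary subset: locally the restriction of a map that is
   smooth on an open subset of the ambient space.  For a submanifold times
   [0, T] this is smoothness up to the end points of [0, T]. *)
Definition smooth_on (A : set V) (f : V -> W) : Prop :=
  forall a, A a -> exists (O : set V) (F : V -> W),
    [/\ open O, O a, smooth_open O F & forall y, O y -> A y -> F y = f y].

End Smoothness.

(* f restricted to A is a homeomorphism from A onto f(A). *)
Definition homeo_on_image {S S' : topologicalType} (A : set S) (f : S -> S') :=
  {within A, continuous f} /\
  exists g : S' -> S,
    {within f @` A, continuous g} /\ (forall x, A x -> g (f x) = x).

Section Geometry.
Context {R : realType} {m n : nat}.
Implicit Types (psi : 'rV[R]_m -> 'rV[R]_n) (f : 'rV[R]_m -> R) (u : 'rV[R]_m).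

Definition dot {d : nat} (x y : 'rV[R]_d) : R := \sum_a x 0 a * y 0 a.

Definition partial {W : normedModType R} (i : 'I_m) (F : 'rV[R]_m -> W)
  : 'rV[R]_m -> W := 'D_(delta_mx 0 i) F.

(* Row i of the Jacobian is the tangent vector d_i psi. *)
Definition jacobian_rows psi u : 'M[R]_(m, n) :=
  \matrix_(i, a) partial i psi u 0 a.

(* In what follows psi : R^m -> R^n is a local parametrization of a
   submanifold, and a function on the submanifold is given by its pull-back
   by psi to the coordinate domain. *)

Definition metric psi u : 'M[R]_m :=
  \matrix_(i, j) dot (partial i psi u) (partial j psi u).

Definition inv_metric psi u : 'M[R]_m := invmx (metric psi u).

Definition tangent_proj psi u : 'M[R]_n :=
  \matrix_(a, b) \sum_i \sum_j
    inv_metric psi u i j * partial i psi u 0 a * partial j psi u 0 b.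

(* (d_i d_j psi)^perp; x *m P is P applied to x since P is symmetric. *)
Definition second_fund psi u (i j : 'I_m) : 'rV[R]_n :=
  let w := partial i (partial j psi) u in w - w *m tangent_proj psi u.

Definition mean_curvature psi u : 'rV[R]_n :=
  \sum_i \sum_j inv_metric psi u i j *: second_fund psi u i j.

Definition tgrad psi f u : 'rV[R]_n :=
  \sum_i \sum_j (inv_metric psi u i j * partial i f u) *: partial j psi u.

Definition tdiv psi (w : 'rV[R]_m -> 'rV[R]_n) u : R :=
  \sum_a tgrad psi (fun u' => w u' 0 a) u 0 a.

Definition laplace_beltrami psi f u : R := tdiv psi (tgrad psi f) u.

Definition f1 psi (P : 'rV[R]_m -> 'M[R]_n) u (a b : 'I_n) : R :=
  2 * \sum_mu dot (tgrad psi (fun u' => P u' a mu) u)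
                  (tgrad psi (fun u' => P u' b mu) u)
  - 4 * \sum_mu \sum_ka P u mu ka *
          dot (tgrad psi (fun u' => P u' a mu) u)
              (tgrad psi (fun u' => P u' b ka) u).

Definition f2 psi (P : 'rV[R]_m -> 'M[R]_n) (H : 'rV[R]_m -> 'rV[R]_n) u
    (a : 'I_n) : R :=
  2 * \sum_mu dot (tgrad psi (fun u' => P u' a mu) u)
                  (tgrad psi (fun u' => H u' 0 mu) u)
  + 4 * \sum_mu \sum_ka
          dot (tgrad psi (fun u' => P u' a mu) u)
              (tgrad psi (fun u' => P u' mu ka) u) * H u 0 ka.

(* Local coordinates on M, with coordinate domain U and parametrization phi. *)
Definition local_param (M : set 'rV[R]_n) (U : set 'rV[R]_m)
    (phi : 'rV[R]_m -> 'rV[R]_n) : Prop :=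
  [/\ open U,
      smooth_open U phi,
      (forall u, U u -> row_free (jacobian_rows phi u)),
      homeo_on_image U phi &
      exists O : set 'rV[R]_n, open O /\ phi @` U = M `&` O].

End Geometry.

Section Evolution.
Context {R : realType}.

(* Closed means compact without boundary. *)
Definition closed_submanifold (m n : nat) (M : set 'rV[R]_n) : Prop :=
  compact M /\
  forall p, M p -> exists (U : set 'rV[R]_m) (phi : 'rV[R]_m -> 'rV[R]_n),
    local_param M U phi /\ (phi @` U) p.

(* Y is an immersion of M that is a homeomorphism onto its image; the
   smoothness of Y is required separately. *)
Definition embedding (m n : nat) (M : set 'rV[R]_n) (Y : 'rV[R]_n -> 'rV[R]_n)
    : Prop :=
  (forall (U : set 'rV[R]_m) (phi : 'rV[R]_m -> 'rV[R]_n), local_param M U phi ->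
     forall u, U u -> row_free (jacobian_rows (Y \o phi) u)) /\
  homeo_on_image M Y.

(* The derivative in time along [0, T] (one-sided at the end points) exists
   and equals l. *)
Definition has_time_deriv {W : normedModType R} (T : R) (c : R -> W) (t : R)
    (l : W) : Prop :=
  (s - t)^-1 *: (c s - c t) @[s --> within `[0, T] t^'] --> l.

(* The material derivative at x = X(p, t) of the field w(x, t). *)
Definition has_material_deriv {n : nat} {W : normedModType R} (T : R)
    (X : 'rV[R]_n -> R -> 'rV[R]_n) (w : 'rV[R]_n -> R -> W)
    (p : 'rV[R]_n) (t : R) (l : W) : Prop :=
  has_time_deriv T (fun s => w (X p s) s) t l.

(* The time slice at t of the moving surface in the coordinates phi. *)
Definition slice {m n : nat} (X : 'rV[R]_n -> R -> 'rV[R]_n)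
    (phi : 'rV[R]_m -> 'rV[R]_n) (t : R) : 'rV[R]_m -> 'rV[R]_n :=
  fun u => X (phi u) t.

(* The field w(x, t) on the surface in the coordinates phi, at time t. *)
Definition pullback {m n : nat} {W : Type} (X : 'rV[R]_n -> R -> 'rV[R]_n)
    (phi : 'rV[R]_m -> 'rV[R]_n) (w : 'rV[R]_n -> R -> W) (t : R)
    : 'rV[R]_m -> W :=
  fun u => w (slice X phi t u) t.

End Evolution.

(* Main.v *)
(** Idea. Let [J] be the matrix whose rows are the tangent vectors [d_i X], let
    [G = (J J^T)^-1] be the inverse metric, [pi = J^T G J], [N = 1 - pi], and
    let [L f = G^kl (d_k d_l f) - b^k d_k f], with [b] the contracted Christoffel
    symbols, be the Laplace-Beltrami operator, so that the flow is
    [d_t X = L X = H].  Applying [L] to [d_i X = d_i X pi] and to [pi = pi pi],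
    and differentiating [H = G^kl d_k d_l X - b^k d_k X], gives
    [d_i X (d_t pi - L pi - f1) = 0] and [N (d_t pi - L pi - f1) N = 0]; the
    remaining block vanishes by symmetry.  Similarly, applying [L] and [d_t] to
    [H pi = 0] gives the tangential part of the equation for [H], and
    differentiating [H = (G^kl d_k d_l X) N] in time gives the normal part.

    These computations take place on an open set of space-time, for a smooth
    extension of the map [(u, t) |-> X (phi u) t] beyond the interval [0, T].
    The flow equation holds on the time slices [t] in [0, T] only, so it may be
    differentiated in space, but not in time. *)
From HB Require Import structures.
Require Import Defs.
From mathcomp Require Import all_boot all_order all_algebra.
From mathcomp Require Import all_classical all_reals all_analysis.
From mathcomp Require Import ring.
Import Order.TTheory GRing.Theory Num.Theory.
Import numFieldNormedType.Exports.
Local Open Scope classical_set_scope.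
Local Open Scope ring_scope.

Set Implicit Arguments.
Unset Strict Implicit.
Unset Printing Implicit Defensive.

(** * Calculus of smooth maps *)

Section SmoothMaps.
Context {R : realType} {V : normedModType R}.
Implicit Types (U : set V).

Lemma open_near_eq {W : Type} U (f g : V -> W) x :
  open U -> U x -> (forall y, U y -> f y = g y) -> \near x, f x = g x.
Proof.
move=> oU Ux fg; have Un : nbhs x U by exact: open_nbhs_nbhs.
by apply: filterS Un.
Qed.

(** [g] is [f] plus a function that vanishes near [x], and such a function has zero differential at
    [x]. *)
Lemma near_eq_differentiable {W : normedModType R} (f g : V -> W) x :
  (\near x, f x = g x) -> differentiable f x -> differentiable g x.
Proof.
move=> fg df; rewrite [g](_ : _ = f + (g - f)); last first.
  by rewrite funeqE => y; rewrite /GRing.add/= addrC subrK.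
have k0 : (g - f) \o shift x = cst ((g - f) x) + (\0 : V -> W) +o_ 0 id.
  apply/eqaddoP => _/posnumP[e]; near=> h => /=.
  have -> : (g - f) x = 0.
    by rewrite -[LHS]/(g x - f x) (nbhs_singleton fg : f x = g x) subrr.
  have E : f (h + x) = g (h + x).
    by near: h; move: fg; rewrite (near_shift 0) => /=; apply: filterS => h /=;
      rewrite subr0.
  rewrite -[X in `|X|]/(g (h + x) - f (h + x) - (0 + 0)).
  by rewrite E subrr addr0 subr0 normr0 mulr_ge0.
apply: differentiableD => //; apply/diff_locallyP.
have c0 : continuous (\0 : V -> W) by exact: cst_continuous.
have lin0 : linear (\0 : V -> W) by move=> a u v; rewrite scaler0 addr0.
pose L : {linear V -> W} :=
  HB.pack (\0 : V -> W) (GRing.isLinear.Build _ _ _ _ _ lin0).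
by rewrite (@diff_unique _ _ _ (g - f) L).
Unshelve. all: by end_near. Qed.

(** Since [U] is open, equality on [U] holds near each of its points and passes to directional
    derivatives. A derivative may thus be replaced by a formula that is valid on [U] only. *)
Lemma Ck_eq {W : normedModType R} k U (f g : V -> W) :
  open U -> (forall x, U x -> f x = g x) -> Ck k U f -> Ck k U g.
Proof.
move=> oU; elim: k f g => [|k IH] f g fg /=.
  move=> cf x Ux; have fgx := open_near_eq oU Ux fg.
  have := cf x Ux; rewrite /prop_for /continuous_at (fg x Ux) => cfx.
  by apply: cvg_trans cfx; apply: near_eq_cvg.
move=> [df cf]; split=> [x Ux|v].
  exact: near_eq_differentiable (open_near_eq oU Ux fg) (df x Ux).
apply: IH (cf v) => x Ux.
exact: near_eq_derive (open_near_eq oU Ux fg).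
Qed.

Lemma CkW {W : normedModType R} k U (f : V -> W) : Ck k.+1 U f -> Ck k U f.
Proof.
elim: k f => [|k IH] f [df cf].
  by move=> x Ux; apply: differentiable_continuous; exact: df.
by split=> // v; exact: IH.
Qed.

Lemma smooth_diff {W : normedModType R} U (f : V -> W) x :
  smooth_open U f -> U x -> differentiable f x.
Proof. by move=> sf Ux; have [df _] := sf 1%N; exact: df. Qed.

Lemma smooth_derivable {W : normedModType R} U (f : V -> W) x v :
  smooth_open U f -> U x -> derivable f x v.
Proof. by move=> sf Ux; apply: diff_derivable; exact: smooth_diff sf Ux. Qed.

Lemma smooth_cts {W : normedModType R} U (f : V -> W) x :
  smooth_open U f -> U x -> {for x, continuous f}.
Proof. by move=> sf; exact: (sf 0%N). Qed.

Lemma smooth_derive {W : normedModType R} U (f : V -> W) v :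
  smooth_open U f -> smooth_open U ('D_v f).
Proof. by move=> sf k; have [_ +] := sf k.+1; apply. Qed.

Lemma smooth_eq {W : normedModType R} U (f g : V -> W) :
  open U -> (forall x, U x -> f x = g x) -> smooth_open U f -> smooth_open U g.
Proof. by move=> oU fg sf k; exact: Ck_eq oU fg (sf k). Qed.

Lemma Ck_sub {W : normedModType R} k U U' (f : V -> W) :
  U' `<=` U -> Ck k U f -> Ck k U' f.
Proof.
move=> UU'; elim: k f => [|k IH] f /=; first by move=> cf x /UU'; exact: cf.
by move=> [df cf]; split=> [x /UU' /df//|v]; apply: IH.
Qed.

Lemma Ck_cst {W : normedModType R} k U (a : W) : Ck k U (cst a : V -> W).
Proof.
elim: k a => [|k IH] a /=; first by move=> x _; exact: cst_continuous.
split=> [x _|v]; first exact: differentiable_cst.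
rewrite (_ : 'D_v (cst a) = cst 0) // funeqE => x; exact: derive_cst.
Qed.

Lemma Ck_comp_linear {W W' : normedModType R} (l : {linear W -> W'}) k U
    (f : V -> W) :
  open U -> continuous l -> Ck k U f -> Ck k U (l \o f).
Proof.
move=> oU cl; elim: k f => [|k IH] f.
  by move=> cf x Ux; apply: continuous_comp; [exact: cf|exact: cl].
move=> [df cf]; have dl y : differentiable l y by exact: linear_differentiable.
split=> [x Ux|v]; first by apply: differentiable_comp => //; exact: df.
apply: Ck_eq (IH _ (cf v)) => // x Ux /=.
rewrite (deriveE _ (df x Ux)) deriveE; last first.
  by apply: differentiable_comp => //; exact: df.
by rewrite (diff_comp (df x Ux) (dl (f x))) /= (diff_lin _ cl).
Qed.

Lemma Ck_add {W : normedModType R} k U (f g : V -> W) :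
  open U -> Ck k U f -> Ck k U g -> Ck k U (f \+ g).
Proof.
move=> oU; elim: k f g => [|k IH] f g /=.
  by move=> cf cg x Ux; apply: cvgD; [exact: cf|exact: cg].
move=> [df cf] [dg cg]; split=> [x Ux|v].
  by apply: differentiableD; [exact: df|exact: dg].
apply: Ck_eq (IH _ _ (cf v) (cg v)) => // x Ux /=.
by rewrite deriveD//; apply: diff_derivable; [exact: df|exact: dg].
Qed.

Lemma Ck_sum {W : normedModType R} k U I (r : seq I) (P : pred I)
    (f : I -> V -> W) :
  open U -> (forall i, Ck k U (f i)) ->
  Ck k U (fun x => \sum_(i <- r | P i) f i x).
Proof.
move=> oU cf; elim: r => [|i r IH].
  by under eq_fun do rewrite big_nil; exact: Ck_cst.
under eq_fun do rewrite big_cons; case: (P i) => //.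
exact: Ck_add.
Qed.

Lemma Ck_mul k U (f g : V -> R) :
  open U -> Ck k U f -> Ck k U g -> Ck k U (f \* g).
Proof.
move=> oU; elim: k f g => [|k IH] f g.
  by move=> cf cg x Ux; apply: cvgM; [exact: cf|exact: cg].
move=> Cf Cg; have [df cf] := Cf; have [dg cg] := Cg; split=> [x Ux|v].
  by apply: differentiableM; [exact: df|exact: dg].
apply: (@Ck_eq _ _ _ ((f \* 'D_v g) \+ (g \* 'D_v f))) => // [x Ux /=|].
  by rewrite deriveM//; apply: diff_derivable; [exact: df|exact: dg].
apply: Ck_add => //; apply: IH.
- exact: CkW Cf.
- exact: cg.
- exact: CkW Cg.
- exact: cf.
Qed.

(** The derivative of [1/f] is [-(1/f)^2 D_v f], in which [1/f] is needed at the lower order only,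
    so the induction on [k] closes. *)
Lemma Ck_inv k U (f : V -> R) :
  open U -> (forall x, U x -> f x != 0) -> Ck k U f ->
  Ck k U (fun x => (f x)^-1).
Proof.
move=> oU f0; elim: k => [|k IH].
  by move=> cf x Ux; apply: cvgV; [exact: f0|exact: cf].
move=> Cf; have [df cf] := Cf; split=> [x Ux|v].
  by apply: differentiableV; [exact: df|exact: f0].
have CV := IH (CkW Cf).
apply: (@Ck_eq _ _ _
  ((cst (-1) \* ((fun x => (f x)^-1) \* (fun x => (f x)^-1))) \* 'D_v f)) => //.
  move=> x Ux /=; rewrite deriveV; [|exact: f0|exact/diff_derivable/df].
  by rewrite /= -exprVn expr2 mulN1r.
apply: (Ck_mul oU) (cf v).
by apply: (Ck_mul oU); [exact: Ck_cst|exact: Ck_mul].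
Qed.

Lemma smooth_mul U (f g : V -> R) : open U ->
  smooth_open U f -> smooth_open U g -> smooth_open U (f \* g).
Proof. by move=> oU sf sg k; exact: Ck_mul oU (sf k) (sg k). Qed.

Lemma smooth_sum {W : normedModType R} U I (r : seq I) (P : pred I)
    (f : I -> V -> W) : open U -> (forall i, smooth_open U (f i)) ->
  smooth_open U (fun x => \sum_(i <- r | P i) f i x).
Proof. by move=> oU sf k; apply: (Ck_sum _ _ oU) => i; exact: sf. Qed.

Lemma smooth_cst {W : normedModType R} U (a : W) :
  smooth_open U (cst a : V -> W).
Proof. by move=> k; exact: Ck_cst. Qed.

Lemma smooth_prod U I (r : seq I) (f : I -> V -> R) : open U ->
  (forall i, smooth_open U (f i)) ->
  smooth_open U (fun x => \prod_(i <- r) f i x).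
Proof.
move=> oU sf; elim: r => [|i r IH].
  by under eq_fun do rewrite big_nil; exact: smooth_cst.
by under eq_fun do rewrite big_cons; exact: smooth_mul.
Qed.

(** * Symmetry of second derivatives *)

Lemma is_derive_line (f : V -> R) (x v : V) (r : R) :
  derivable f (x + r *: v) v ->
  is_derive r 1 (fun s => f (x + s *: v)) ('D_v f (x + r *: v)).
Proof.
move=> df.
have E : (fun h : R => h^-1 *: (f (x + (h *: 1 + r) *: v) - f (x + r *: v))) =
    (fun h => h^-1 *: (f (h *: v + (x + r *: v)) - f (x + r *: v))).
  apply/funext => h; congr (_ *: (f _ - _)).
  by rewrite [h *: 1]mulr1 scalerDl addrCA.
by split; rewrite /derivable /derive /= ?[X in cvg (X @ _)]E
  ?[X in lim (X @ _)]E.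
Qed.

Lemma nbhs_parallelogram (x v w : V) (A : set V) : nbhs x A ->
  exists2 t : R, 0 < t & forall r s : R, `|r| <= t -> `|s| <= t ->
    A (x + r *: v + s *: w).
Proof.
move=> Ax; pose q (p : R * R) : V := x + p.1 *: v + p.2 *: w.
have cq : {for (0, 0), continuous q}.
  apply: (@continuousD _ _ _ (fun p : R * R => x + p.1 *: v)).
    apply: continuousD; first exact: cst_continuous.
    by apply: cvgZr_tmp; exact: cvg_fst.
  by apply: cvgZr_tmp; exact: cvg_snd.
have : nbhs (q (0, 0)) A by rewrite /q /= !scale0r !addr0.
move=> /cq /nbhs_ballP [d /= d0 dA].
exists (d / 2) => [|r s rd sd]; first exact: divr_gt0.
by apply: (dA (r, s)); split; rewrite -ball_normE /= sub0r normrN;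
  apply: le_lt_trans (_ : d / 2 < d) => //;
  rewrite ltr_pdivrMr// ltr_pMr// ltr1n.
Qed.

(** The mean value theorem is applied twice: in direction [v] to the increment of [f] along
    [t *: w], then in direction [w] to ['D_v f] at the parameter found. *)
Lemma second_difference (U : set V) (f : V -> R) (x v w : V) (t : R) :
  0 < t -> smooth_open U f ->
  (forall r s : R, `|r| <= t -> `|s| <= t -> U (x + r *: v + s *: w)) ->
  exists r s : R, [/\ `|r| <= t, `|s| <= t &
    f (x + t *: v + t *: w) - f (x + t *: v) - (f (x + t *: w) - f x) =
    'D_w ('D_v f) (x + r *: v + s *: w) * (t * t)].
Proof.
move=> t0 sf Ut.
have itvn (r : R) : r \in `[0, t] -> `|r| <= t.
  by rewrite in_itv/= => /andP[r0 rt]; rewrite ger0_norm.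
have itvoo (r : R) : r \in `]0, t[ -> r \in `[0, t] by apply: subset_itv_oo_cc.
pose p r := f (x + t *: w + r *: v) - f (x + r *: v).
pose dp r := 'D_v f (x + t *: w + r *: v) - 'D_v f (x + r *: v).
have dph r : r \in `[0, t] -> is_derive r 1 p (dp r).
  move=> /itvn rt; apply: is_deriveB; apply: is_derive_line;
      apply: smooth_derivable sf _.
    by rewrite addrAC; apply: Ut; rewrite // ger0_norm// ltW.
  by have := Ut r 0 rt; rewrite scale0r addr0 normr0; apply; exact: ltW.
have cp : {within `[0, t], continuous p}.
  by apply: derivable_within_continuous => r /dph [].
have [r rt pE] := MVT t0 (fun r rt => dph r (itvoo r rt)) cp.
have rtn := itvn r (itvoo r rt).
pose q s := 'D_v f (x + r *: v + s *: w).
pose dq s := 'D_w ('D_v f) (x + r *: v + s *: w).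
have dqh s : s \in `[0, t] -> is_derive s 1 q (dq s).
  move=> /itvn st; apply: is_derive_line.
  apply: smooth_derivable (smooth_derive _ sf) _.
  exact: Ut.
have cq : {within `[0, t], continuous q}.
  by apply: derivable_within_continuous => s /dqh [].
have [s st qE] := MVT t0 (fun s st => dqh s (itvoo s st)) cq.
exists r, s; split=> //; first exact: (itvn s (itvoo s st)).
rewrite -/(dq s) mulrA -[X in dq s * X]subr0 -qE.
have -> : q t - q 0 = dp r.
  by rewrite /q /dp scale0r addr0 addrAC.
rewrite -[X in dp r * X]subr0 -pE /p !scale0r !addr0.
by rewrite [x + t *: w + _]addrAC.
Qed.

(* Schwarz's theorem: both iterated derivatives are approximated by the same
   second difference quotient. *)
Lemma derive_comm (U : set V) (f : V -> R) (x v w : V) :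
  open U -> U x -> smooth_open U f ->
  'D_v ('D_w f) x = 'D_w ('D_v f) x.
Proof.
move=> oU Ux sf.
set a := LHS; set b := RHS.
apply/eqP; rewrite -subr_eq0 -normr_le0.
apply/ler_addgt0Pl => e e0; rewrite addr0.
have e20 : 0 < e / 2 by exact: divr_gt0.
have Un : nbhs x U by exact: open_nbhs_nbhs.
have ca : {for x, continuous ('D_v ('D_w f))}.
  by apply: smooth_cts Ux; do 2! apply: smooth_derive.
have cb : {for x, continuous ('D_w ('D_v f))}.
  by apply: smooth_cts Ux; do 2! apply: smooth_derive.
have na : \forall y \near x, `|a - 'D_v ('D_w f) y| < e / 2.
  by move/cvgrPdist_lt : ca; apply.
have nb : \forall y \near x, `|b - 'D_w ('D_v f) y| < e / 2.
  by move/cvgrPdist_lt : cb; apply.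
have [t t0 tA] := nbhs_parallelogram v w (filterI Un (filterI na nb)).
have [r [s [rt st E]]] :=
  second_difference t0 sf (fun r s rt st => (tA r s rt st).1).
have [|s' [r' [st' rt' E']]] := @second_difference U f x w v t t0 sf.
  by move=> s' r' st' rt'; rewrite addrAC; exact: (tA r' s' rt' st').1.
have [_ [_ B]] := tA r s rt st.
have [_ [A _]] := tA r' s' rt' st'; rewrite addrAC in A.
(* The second difference is symmetric in [v] and [w], so the two mean values, taken at different
   points near [x], are equal. *)
have EE : 'D_v ('D_w f) (x + s' *: w + r' *: v) =
    'D_w ('D_v f) (x + r *: v + s *: w).
  have tt : t * t != 0 by rewrite mulf_neq0// gt_eqF.
  apply: (mulIf tt); apply: etrans (esym E') (etrans _ E).
  by rewrite [x + t *: w + _]addrAC; ring.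
rewrite /= in A B; rewrite EE in A.
rewrite [e]splitr -(subrKA ('D_w ('D_v f) (x + r *: v + s *: w))).
apply: le_trans (ler_normD _ _) _; apply: lerD; first exact: ltW A.
rewrite distrC; exact: ltW B.
Qed.

End SmoothMaps.

(** * Smooth matrix-valued maps *)

(* Locked: unification would otherwise unfold derivatives down to limits. *)
HB.lock Definition mxderive {R : realType} {V : normedModType R} {p q : nat}
  (v : V) (M : V -> 'M[R]_(p, q)) (z : V) : 'M[R]_(p, q) := 'D_v M z.

Section SmoothMatrices.
Context {R : realType} {V : normedModType R}.
Variables (U : set V) (oU : open U).

(** Entrywise smoothness reduces products, determinants and inverses to scalar calculus. *)
Definition smooth_mx p q (M : V -> 'M[R]_(p, q)) : Prop :=
  forall i j, smooth_open U (fun z => M z i j).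

Lemma smooth_mx_eq p q (M N : V -> 'M[R]_(p, q)) :
  (forall z, U z -> M z = N z) -> smooth_mx M -> smooth_mx N.
Proof.
by move=> MN sM i j; apply: smooth_eq (sM i j) => // x Ux; rewrite MN.
Qed.

Lemma smooth_mx_derivable p q (M : V -> 'M[R]_(p, q)) z v :
  smooth_mx M -> U z -> derivable M z v.
Proof.
move=> sM Uz; apply/derivable_mxP => i j.
exact: smooth_derivable (sM i j) Uz.
Qed.

Lemma mxderiveE p q (M : V -> 'M[R]_(p, q)) z v i j :
  smooth_mx M -> U z -> mxderive v M z i j = 'D_v (fun z => M z i j) z.
Proof.
move=> sM Uz; rewrite mxderive.unlock derive_mx ?mxE//.
exact: smooth_mx_derivable.
Qed.

Lemma smooth_mxderive p q (M : V -> 'M[R]_(p, q)) v :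
  smooth_mx M -> smooth_mx (mxderive v M).
Proof.
move=> sM i j; apply: smooth_eq (smooth_derive v (sM i j)) => // z Uz.
by rewrite mxderiveE.
Qed.

Lemma mxderive_eq p q (M N : V -> 'M[R]_(p, q)) z v :
  U z -> (forall z, U z -> M z = N z) -> mxderive v M z = mxderive v N z.
Proof.
move=> Uz MN; rewrite mxderive.unlock; apply: near_eq_derive.
exact: open_near_eq MN.
Qed.

Lemma mxderive_comm p q (M : V -> 'M[R]_(p, q)) z v w :
  smooth_mx M -> U z ->
  mxderive v (mxderive w M) z = mxderive w (mxderive v M) z.
Proof.
move=> sM Uz; apply/matrixP => i j.
have D a b : mxderive a (mxderive b M) z i j = 'D_a ('D_b (fun z => M z i j)) z.
  rewrite mxderiveE//; last exact: smooth_mxderive.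
  apply: near_eq_derive; apply: (open_near_eq oU Uz) => y Uy; exact: mxderiveE.
exact: etrans (D v w) (etrans (derive_comm v w oU Uz (sM i j)) (esym (D w v))).
Qed.

Lemma smooth_mx_add p q (M N : V -> 'M[R]_(p, q)) :
  smooth_mx M -> smooth_mx N -> smooth_mx (fun z => M z + N z).
Proof.
move=> sM sN i j k; under eq_fun do rewrite mxE.
exact: Ck_add oU (sM i j k) (sN i j k).
Qed.

Lemma smooth_mx_scale p q (f : V -> R) (M : V -> 'M[R]_(p, q)) :
  smooth_open U f -> smooth_mx M -> smooth_mx (fun z => f z *: M z).
Proof.
by move=> sf sM i j; under eq_fun do rewrite mxE; exact: smooth_mul.
Qed.

Lemma smooth_mx_opp p q (M : V -> 'M[R]_(p, q)) :
  smooth_mx M -> smooth_mx (fun z => - M z).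
Proof.
move=> sM; apply: (@smooth_mx_eq _ _ (fun z => (- 1) *: M z)) => [z _|].
  by rewrite scaleN1r.
by apply: (@smooth_mx_scale _ _ (cst (- 1))) => //; exact: smooth_cst.
Qed.

Lemma smooth_mx_sub p q (M N : V -> 'M[R]_(p, q)) :
  smooth_mx M -> smooth_mx N -> smooth_mx (fun z => M z - N z).
Proof. by move=> sM sN; apply: smooth_mx_add => //; exact: smooth_mx_opp. Qed.

Lemma smooth_mx_sum p q I (r : seq I) (M : I -> V -> 'M[R]_(p, q)) :
  (forall i, smooth_mx (M i)) -> smooth_mx (fun z => \sum_(i <- r) M i z).
Proof.
move=> sM i j; under eq_fun do rewrite summxE.
by apply: smooth_sum => // k; exact: sM.
Qed.

Lemma smooth_mx_mul p q r (M : V -> 'M[R]_(p, q)) (N : V -> 'M[R]_(q, r)) :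
  smooth_mx M -> smooth_mx N -> smooth_mx (fun z => M z *m N z).
Proof.
move=> sM sN i j; under eq_fun do rewrite mxE.
by apply: smooth_sum => // k; apply: (smooth_mul oU); [exact: sM|exact: sN].
Qed.

Lemma smooth_mx_tr p q (M : V -> 'M[R]_(p, q)) :
  smooth_mx M -> smooth_mx (fun z => (M z)^T).
Proof. by move=> sM i j; under eq_fun do rewrite mxE; exact: sM. Qed.

Lemma smooth_mx_row p q (M : V -> 'M[R]_(p, q)) i :
  smooth_mx M -> smooth_mx (fun z => row i (M z)).
Proof. by move=> sM j k; under eq_fun do rewrite mxE; exact: sM. Qed.

Lemma smooth_mx_det p (M : V -> 'M[R]_p) :
  smooth_mx M -> smooth_open U (fun z => \det (M z)).
Proof.
move=> sM; apply: smooth_sum => // s; apply: smooth_mul => //.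
  exact: smooth_cst.
by apply: smooth_prod => // i; exact: sM.
Qed.

(** Cramer's formula: the inverse is [(det M)^-1] times the adjugate, whose entries are determinants
    up to sign. *)
Lemma smooth_mx_inv p (M : V -> 'M[R]_p) :
  (forall z, U z -> M z \in unitmx) -> smooth_mx M ->
  smooth_mx (fun z => invmx (M z)).
Proof.
move=> uM sM.
have sdet := smooth_mx_det sM.
have sV : smooth_open U (fun z => (\det (M z))^-1).
  by move=> k; apply: Ck_inv => // z Uz; rewrite -unitfE -unitmxE uM.
have sadj : smooth_mx (fun z => \adj (M z)).
  move=> i j; under eq_fun do rewrite mxE.
  apply: smooth_mul => //; first exact: smooth_cst.
  apply: smooth_mx_det => k l; under eq_fun do rewrite !mxE.
  exact: sM.
apply: smooth_mx_eq (smooth_mx_scale sV sadj) => z Uz.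
by rewrite /invmx uM.
Qed.

(** * Differentiation rules for matrix-valued maps *)

Section Rules.
Variables (z v : V) (Uz : U z).

Lemma mxderive_cst p q (A : 'M[R]_(p, q)) : mxderive v (cst A) z = 0.
Proof. by rewrite mxderive.unlock derive_cst. Qed.

Lemma mxderiveD p q (M N : V -> 'M[R]_(p, q)) : smooth_mx M -> smooth_mx N ->
  mxderive v (fun z => M z + N z) z = mxderive v M z + mxderive v N z.
Proof.
move=> sM sN; rewrite mxderive.unlock deriveD//; exact: smooth_mx_derivable.
Qed.

Lemma mxderiveB p q (M N : V -> 'M[R]_(p, q)) : smooth_mx M -> smooth_mx N ->
  mxderive v (fun z => M z - N z) z = mxderive v M z - mxderive v N z.
Proof.
move=> sM sN; rewrite mxderive.unlock deriveB//; exact: smooth_mx_derivable.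
Qed.

Lemma mxderiveM p q r (M : V -> 'M[R]_(p, q)) (N : V -> 'M[R]_(q, r)) :
  smooth_mx M -> smooth_mx N ->
  mxderive v (fun z => M z *m N z) z =
  mxderive v M z *m N z + M z *m mxderive v N z.
Proof.
move=> sM sN; apply/matrixP => i j.
rewrite mxderiveE//; last exact: smooth_mx_mul.
rewrite (_ : (fun z => _) = \sum_k (fun z => M z i k * N z k j)); last first.
  by apply/funext => y; rewrite mxE fct_sumE.
rewrite derive_sum => [|k]; last first.
  by apply: derivableM; apply: smooth_derivable Uz; [exact: sM|exact: sN].
rewrite !mxE -big_split; apply: eq_bigr => k _ /=.
rewrite deriveM; [|exact: smooth_derivable (sM _ _) Uz|
  exact: smooth_derivable (sN _ _) Uz].
by rewrite !mxderiveE// addrC; congr (_ + _); exact: mulrC.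
Qed.

Lemma mxderive_tr p q (M : V -> 'M[R]_(p, q)) : smooth_mx M ->
  mxderive v (fun z => (M z)^T) z = (mxderive v M z)^T.
Proof.
move=> sM; apply/matrixP => i j; rewrite mxE !mxderiveE//; last first.
  exact: smooth_mx_tr.
by under eq_fun do rewrite mxE.
Qed.

Lemma mxderive_row p q (M : V -> 'M[R]_(p, q)) i : smooth_mx M ->
  mxderive v (fun z => row i (M z)) z = row i (mxderive v M z).
Proof.
move=> sM; apply/matrixP => j k; rewrite mxE !mxderiveE//; last first.
  exact: smooth_mx_row.
by under eq_fun do rewrite mxE.
Qed.

Lemma mxderive_scale p q (f : V -> R) (M : V -> 'M[R]_(p, q)) :
  smooth_open U f -> smooth_mx M ->
  mxderive v (fun z => f z *: M z) z =
  'D_v f z *: M z + f z *: mxderive v M z.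
Proof.
move=> sf sM; apply/matrixP => i j.
rewrite mxderiveE//; last exact: smooth_mx_scale.
rewrite (_ : (fun z => _) = f * (fun z => M z i j)); last first.
  by apply/funext => y; rewrite mxE.
rewrite deriveM; [|exact: smooth_derivable sf Uz|
  exact: smooth_derivable (sM _ _) Uz].
by rewrite !mxE mxderiveE// addrC; congr (_ + _); exact: mulrC.
Qed.

Lemma mxderive_sum p q k (M : 'I_k -> V -> 'M[R]_(p, q)) :
  (forall i, smooth_mx (M i)) ->
  mxderive v (fun z => \sum_i M i z) z = \sum_i mxderive v (M i) z.
Proof.
move=> sM; rewrite mxderive.unlock (_ : (fun z => _) = \sum_i M i); last first.
  by apply/funext => y; rewrite fct_sumE.
by rewrite derive_sum// => i; exact: smooth_mx_derivable.
Qed.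

(** Differentiate [M^-1 M = 1] and multiply by [M^-1] on the right. *)
Lemma mxderiveV p (M : V -> 'M[R]_p) :
  (forall z, U z -> M z \in unitmx) -> smooth_mx M ->
  mxderive v (fun z => invmx (M z)) z =
  - (invmx (M z) *m mxderive v M z *m invmx (M z)).
Proof.
move=> uM sM; have sV := smooth_mx_inv uM sM.
have : mxderive v (fun z => invmx (M z) *m M z) z = 0.
  rewrite (@mxderive_eq _ _ _ (cst 1%:M)) ?mxderive_cst// => y Uy.
  by rewrite mulVmx ?uM.
rewrite mxderiveM// => /(congr1 (mulmx^~ (invmx (M z)))) /=.
rewrite mulmxDl mul0mx mulmxK ?uM// => /eqP.
by rewrite addr_eq0 => /eqP.
Qed.

End Rules.

End SmoothMatrices.

(** * Smooth maps on space-time *)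

Section SpaceTime.
Context {R : realType} {m n : nat}.

Local Notation E d := ('rV[R]_d * R)%type.

Lemma differentiable_fst {d : nat} (z : E d) :
  differentiable (fst : E d -> 'rV[R]_d) z.
Proof. by apply: linear_differentiable => x; exact: cvg_fst. Qed.

Lemma smooth_fst {d : nat} (U : set 'rV[R]_d) (A : set (E d))
    (f : 'rV[R]_d -> R) :
  (forall z, A z -> U z.1) -> smooth_open U f ->
  smooth_open A (fun z : E d => f z.1).
Proof.
move=> AU sf k; elim: k f sf => [|k IH] f sf.
  move=> z Az; apply: continuous_comp; first exact: cvg_fst.
  exact: smooth_cts sf (AU _ Az).
split=> [z Az|v].
  apply: differentiable_comp; first exact: differentiable_fst.
  exact: smooth_diff sf (AU _ Az).
(* The derivative of [f z.1] along [v] is convertible with that of [f] along [v.1], taken at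
   [z.1]. *)
exact: (IH ('D_(v.1) f) (smooth_derive _ sf)).
Qed.

Lemma smooth_entry {V : normedModType R} (U : set V) d (f : V -> 'rV[R]_d) a :
  open U -> smooth_open U f -> smooth_open U (fun z => f z 0 a).
Proof.
move=> oU sf k.
have lin : linear (fun M : 'rV[R]_d => M 0 a) by move=> c x y; rewrite !mxE.
pose L : {linear 'rV[R]_d -> R} :=
  HB.pack (fun M : 'rV[R]_d => M 0 a) (GRing.isLinear.Build _ _ _ _ _ lin).
by apply: (Ck_comp_linear (l := L)) => // M; exact: coord_continuous.
Qed.

Lemma pair_rV_basis d (w : 'rV[R]_d) (s : R) :
  (w, s) = \sum_i w 0 i *: ((delta_mx 0 i, 0) : E d) + s *: ((0, 1) : E d).
Proof.
have S1 : (\sum_i w 0 i *: ((delta_mx 0 i, 0) : E d)).1 = w.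
  by rewrite raddf_sum [RHS]row_sum_delta.
have S2 : (\sum_i w 0 i *: ((delta_mx 0 i, 0) : E d)).2 = 0.
  by rewrite raddf_sum big1 // => i _; rewrite /= scaler0.
rewrite [X in X + _]surjective_pairing S1 S2.
by congr pair; rewrite /= ?scaler0 ?addr0// [_ *: _]mulr1 add0r.
Qed.

(** Coordinates in space, identity in time. A smooth extension of the flow map lives on [E n];
    composing with this map brings it to [E m]. *)
Definition lift_space (phi : 'rV[R]_m -> 'rV[R]_n) (z : E m) : E n :=
  (phi z.1, z.2).

Lemma differentiable_lift_space phi z :
  differentiable phi z.1 -> differentiable (lift_space phi) z.
Proof.
move=> dphi; apply: differentiable_pair.
  by apply: (differentiable_comp (differentiable_fst z)).
by apply: linear_differentiable => x; exact: cvg_snd.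
Qed.

Lemma derive_lift_space phi z v : differentiable phi z.1 ->
  'D_v (lift_space phi) z = ('D_(v.1) phi z.1, v.2).
Proof.
move=> dphi; rewrite deriveE; last exact: differentiable_lift_space.
rewrite diff_pair; last 2 first.
- exact: (differentiable_comp (differentiable_fst z)).
- by apply: linear_differentiable => x; exact: cvg_snd.
congr pair.
  by rewrite -deriveE//; exact: (differentiable_comp (differentiable_fst z)).
by rewrite diff_lin // => x; exact: cvg_snd.
Qed.

Variables (U : set 'rV[R]_m) (phi : 'rV[R]_m -> 'rV[R]_n) (O : set (E n)).
Hypotheses (oU : open U) (sphi : smooth_open U phi) (oO : open O).

Definition lift_domain : set (E m) := [set z | U z.1 /\ O (lift_space phi z)].

Lemma lift_domain_open : open lift_domain.
Proof.
rewrite openE => z [Uz Oz]; rewrite /interior.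
have nU : nbhs z (fst @^-1` U).
  apply: (differentiable_continuous (differentiable_fst z)).
  exact: open_nbhs_nbhs.
have nO : nbhs z (lift_space phi @^-1` O).
  apply: (differentiable_continuous
    (differentiable_lift_space (smooth_diff sphi Uz))).
  exact: open_nbhs_nbhs.
exact: filterS2 (fun z Uz Oz => conj Uz Oz) nU nO.
Qed.

(** By the chain rule and [pair_rV_basis], a derivative of the composite is a finite sum of
    products: a derivative of [phi], or a constant, times a derivative of [f] in a fixed direction
    composed with the same map. Hence the induction runs over all [f] at once. *)
Lemma smooth_lift (f : E n -> R) :
  smooth_open O f -> smooth_open lift_domain (f \o lift_space phi).
Proof.
move=> sf k; elim: k f sf => [|k IH] f sf.
  move=> z [Uz Oz]; apply: continuous_comp; last exact: smooth_cts sf Oz.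
  exact: (differentiable_continuous
    (differentiable_lift_space (smooth_diff sphi Uz))).
have d z : lift_domain z -> differentiable (f \o lift_space phi) z.
  move=> [Uz Oz]; apply: differentiable_comp; last exact: smooth_diff sf Oz.
  exact: differentiable_lift_space (smooth_diff sphi Uz).
split=> // v; have oD := lift_domain_open.
apply: (@Ck_eq _ _ _ _ _ ((fun z => \sum_i ('D_(v.1) phi z.1 0 i *
    'D_((delta_mx 0 i, 0) : E n) f (lift_space phi z))) \+
    (fun z => v.2 * 'D_((0, 1) : E n) f (lift_space phi z)))) => //.
  move=> z Dz; have [Uz Oz] := Dz; have dphi := smooth_diff sphi Uz.
  rewrite deriveE; last exact: d.
  rewrite (diff_comp (differentiable_lift_space dphi) (smooth_diff sf Oz)) /=.
  rewrite -[X in 'd f _ X]deriveE; last exact: differentiable_lift_space.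
  rewrite derive_lift_space// [X in 'd f _ X]pair_rV_basis.
  rewrite linearD linear_sum /=.
  congr (_ + _).
    by apply: eq_bigr => i _; rewrite linearZ (deriveE _ (smooth_diff sf Oz)).
  by rewrite linearZ (deriveE _ (smooth_diff sf Oz)).
apply: Ck_add => //.
  apply: Ck_sum => // i; apply: Ck_mul => //.
    apply: (@smooth_fst _ U _ (fun u => 'D_(v.1) phi u 0 i)).
      by move=> z [].
    by apply: smooth_entry => //; exact: smooth_derive.
  by apply: (IH ('D_((delta_mx 0 i, 0) : E n) f)); exact: smooth_derive.
apply: (Ck_mul (f := cst v.2) oD); first exact: Ck_cst.
apply: (IH ('D_((0, 1) : E n) f)); exact: smooth_derive.
Qed.

End SpaceTime.

(** * Algebra of the evolution equations *)

Section Contraction.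
Context {F : comNzRingType} {m : nat}.
Implicit Types (G X : 'M[F]_m).

(** Index notation [G^kl f_kl]; [G] will be the inverse metric or a derivative of it. *)
Definition contr {p q : nat} G (f : 'I_m -> 'I_m -> 'M[F]_(p, q)) :
    'M[F]_(p, q) :=
  \sum_k \sum_l G k l *: f k l.

Lemma eq_contr p q G (f h : 'I_m -> 'I_m -> 'M[F]_(p, q)) :
  (forall k l, f k l = h k l) -> contr G f = contr G h.
Proof.
by move=> fh; apply: eq_bigr => k _; apply: eq_bigr => l _; rewrite fh.
Qed.

Lemma contrD p q G (f h : 'I_m -> 'I_m -> 'M[F]_(p, q)) :
  contr G (fun k l => f k l + h k l) = contr G f + contr G h.
Proof.
rewrite -big_split; apply: eq_bigr => k _; rewrite -big_split.
by apply: eq_bigr => l _; rewrite scalerDr.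
Qed.

Lemma contrN p q G (f : 'I_m -> 'I_m -> 'M[F]_(p, q)) :
  contr G (fun k l => - f k l) = - contr G f.
Proof.
rewrite -sumrN; apply: eq_bigr => k _; rewrite -sumrN.
by apply: eq_bigr => l _; rewrite scalerN.
Qed.

Lemma contr0 p q G : contr G (fun _ _ => 0 : 'M[F]_(p, q)) = 0.
Proof.
by rewrite /contr big1// => k _; rewrite big1// => l _; rewrite scaler0.
Qed.

Lemma contrDl p q G X (f : 'I_m -> 'I_m -> 'M[F]_(p, q)) :
  contr (G + X) f = contr G f + contr X f.
Proof.
rewrite -big_split; apply: eq_bigr => k _; rewrite -big_split.
by apply: eq_bigr => l _; rewrite mxE scalerDl.
Qed.

Lemma contrNl p q G (f : 'I_m -> 'I_m -> 'M[F]_(p, q)) :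
  contr (- G) f = - contr G f.
Proof.
rewrite -sumrN; apply: eq_bigr => k _; rewrite -sumrN.
by apply: eq_bigr => l _; rewrite mxE scaleNr.
Qed.

Lemma contr_mull p q r G (A : 'M[F]_(r, p)) (f : 'I_m -> 'I_m -> 'M[F]_(p, q)) :
  A *m contr G f = contr G (fun k l => A *m f k l).
Proof.
rewrite mulmx_sumr; apply: eq_bigr => k _; rewrite mulmx_sumr.
by apply: eq_bigr => l _; rewrite scalemxAr.
Qed.

Lemma contr_mulr p q r G (A : 'M[F]_(q, r)) (f : 'I_m -> 'I_m -> 'M[F]_(p, q)) :
  contr G f *m A = contr G (fun k l => f k l *m A).
Proof.
rewrite mulmx_suml; apply: eq_bigr => k _; rewrite mulmx_suml.
by apply: eq_bigr => l _; rewrite scalemxAl.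
Qed.

Lemma contr_swap p q G (f : 'I_m -> 'I_m -> 'M[F]_(p, q)) :
  contr G f = contr G^T (fun k l => f l k).
Proof.
rewrite /contr exchange_big; apply: eq_bigr => k _; apply: eq_bigr => l _.
by rewrite mxE.
Qed.

Lemma contr_tr p q G (f : 'I_m -> 'I_m -> 'M[F]_(p, q)) :
  (contr G f)^T = contr G (fun k l => (f k l)^T).
Proof.
rewrite raddf_sum; apply: eq_bigr => k _; rewrite raddf_sum.
by apply: eq_bigr => l _; apply/matrixP => a b; rewrite !mxE.
Qed.

Lemma mulmxMnr p q r k (A : 'M[F]_(p, q)) (B : 'M[F]_(q, r)) :
  A *m (B *+ k) = A *m B *+ k.
Proof. by rewrite -!scaler_nat scalemxAr. Qed.

Lemma mulmxMnl p q r k (A : 'M[F]_(p, q)) (B : 'M[F]_(q, r)) :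
  (A *+ k) *m B = A *m B *+ k.
Proof. by rewrite -!scaler_nat scalemxAl. Qed.

(** Summing first over the column index [r] of [X G] produces the row vector [row k X *m G *m A l];
    the remaining factor [G^lk] is symmetric. *)
Lemma contr_sandwich q G X (A : 'I_m -> 'M[F]_(m, q)) : G^T = G ->
  contr (G *m X *m G) (fun l r => row r (A l)) =
  contr G (fun k l => row k X *m G *m A l).
Proof.
move=> Gs; rewrite [RHS]contr_swap Gs; apply: eq_bigr => l _.
under [RHS]eq_bigr do rewrite mulmx_sum_row scaler_sumr.
rewrite exchange_big; apply: eq_bigr => r _; rewrite -mulmxA mxE.
rewrite scaler_suml; apply: eq_bigr => k _; rewrite scalerA; congr (_ * _ *: _).
by rewrite -row_mul !mxE.
Qed.

(** Made for the derivative [-G (X + X^T) G] of the inverse metric: against a symmetric object such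
    as the second fundamental form, both summands contribute equally. *)
Lemma contr_sym_double q G X (A : 'I_m -> 'M[F]_(m, q)) :
  G^T = G -> (forall k l, row l (A k) = row k (A l)) ->
  contr (G *m (X + X^T) *m G) (fun k l => row l (A k)) =
  contr (G *m X *m G) (fun k l => row l (A k)) *+ 2.
Proof.
move=> Gs As; rewrite mulmxDr mulmxDl contrDl mulr2n; congr (_ + _).
rewrite contr_swap !trmx_mul trmxK Gs mulmxA.
by apply: eq_contr => k l; rewrite As.
Qed.

End Contraction.

Section ProjectionVariation.
Context {F : comNzRingType} {m n : nat}.
Variables (J dJ : 'M[F]_(m, n)) (G dG : 'M[F]_m).
Hypotheses (Gs : G^T = G) (gG : J *m J^T *m G = 1%:M).
Hypothesis dGE : dG = - (G *m (dJ *m J^T + J *m dJ^T) *m G).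

Let p := J^T *m G *m J.

(** The [dG] term equals [-p dJ^T G J - J^T G dJ p], which removes the tangential part from the two
    outer terms. *)
Lemma projection_variation :
  dJ^T *m G *m J + J^T *m dG *m J + J^T *m G *m dJ =
  (1%:M - p) *m dJ^T *m G *m J + J^T *m G *m dJ *m (1%:M - p).
Proof.
rewrite dGE /p !mulmxBl !mulmxBr !mul1mx !mulmx1 mulmxN mulNmx.
rewrite mulmxDr mulmxDl mulmxDr mulmxDl !mulmxA.
set a := dJ^T *m G *m J; set b := J^T *m G *m dJ.
set c := _ *m dJ *m _ *m _ *m _; set d := _ *m dJ^T *m _ *m _.
by rewrite opprD addrA [a - c - d]addrAC -!addrA [- c + b]addrC.
Qed.

End ProjectionVariation.

(* Dictionary, at a point: [J] is the matrix of tangent vectors [e_i], [G] the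
   inverse metric, [E k], [P k], [dG k] the derivatives of [J], [p], [G] along
   the k-th coordinate, [Jt], [pt], [Gt], [Ht], [wt] the time derivatives of [J],
   [p], [G], [H], [w]; [Lp], [Le i], [LH] the Laplacians of [p], [e_i], [H];
   [w = G^kl d_k d_l X], [b] its coordinates along the tangent vectors, [c i] the
   i-th derivative of [b], and [S = G^kl d_k d_l H]. *)
Section EvolutionAlgebra.
Context {F : comNzRingType} {m n : nat}.
Variables (J : 'M[F]_(m, n)) (G : 'M[F]_m) (E : 'I_m -> 'M[F]_(m, n)).
Hypotheses (Gs : G^T = G) (gG : J *m J^T *m G = 1%:M).
Hypothesis Es : forall i k, row i (E k) = row k (E i).

Variables p N : 'M[F]_n.
Hypotheses (pE : p = J^T *m G *m J) (NE : N = 1%:M - p).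
(* The variation of the projection when the frame varies by [D]. *)
Let dp (D : 'M[F]_(m, n)) := N *m D^T *m G *m J + J^T *m G *m D *m N.
Variable P : 'I_m -> 'M[F]_n.
Hypothesis PE : forall k, P k = dp (E k).

Let ps : p^T = p. Proof. by rewrite pE !trmx_mul trmxK Gs mulmxA. Qed.
Let Ns : N^T = N. Proof. by rewrite NE linearB /= ps trmx1. Qed.
Let Jp : J *m p = J. Proof. by rewrite pE !mulmxA gG mul1mx. Qed.
Let pJ : p *m J^T = J^T. Proof. by rewrite -[in LHS]ps -trmx_mul Jp. Qed.
Let pp : p *m p = p. Proof. by rewrite {1}pE -!mulmxA Jp mulmxA. Qed.
Let JN : J *m N = 0. Proof. by rewrite NE mulmxBr mulmx1 Jp subrr. Qed.
Let NJ : N *m J^T = 0. Proof. by rewrite NE mulmxBl mul1mx pJ subrr. Qed.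
Let pN : p *m N = 0. Proof. by rewrite NE mulmxBr mulmx1 pp subrr. Qed.
Let Np : N *m p = 0. Proof. by rewrite NE mulmxBl mul1mx pp subrr. Qed.
Let NN : N *m N = N. Proof. by rewrite {1}NE mulmxBl mul1mx pN subr0. Qed.

Let dps D : (dp D)^T = dp D.
Proof. by rewrite /dp linearD /= !trmx_mul !trmxK Gs Ns !mulmxA addrC. Qed.

Let Jdp D : J *m dp D = D *m N.
Proof. by rewrite mulmxDr !mulmxA JN !mul0mx add0r gG mul1mx. Qed.

(** This is the derivative of [p p = p]: a variation of the projection exchanges tangent and normal
    space. *)
Let dpN D : dp D *m N = p *m dp D.
Proof.
rewrite mulmxDl mulmxDr.
rewrite -!mulmxA JN !mulmx0 add0r NN.
by rewrite !mulmxA pN !mul0mx add0r pJ.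
Qed.

Let pdpp D : p *m dp D *m p = 0.
Proof. by rewrite -dpN -mulmxA Np mulmx0. Qed.

(** Row [l] of [A k] is the second fundamental form [A_kl]. *)
Let A k := E k *m N.
Let As k l : row l (A k) = row k (A l).
Proof. by rewrite !row_mul Es. Qed.

Variables (H : 'rV[F]_n) (Jt : 'M[F]_(m, n)).
Variables (Lp : 'M[F]_n) (Le : 'I_m -> 'rV[F]_n) (c : 'I_m -> 'rV[F]_m).
Variables (dG : 'I_m -> 'M[F]_m).
Hypothesis LpT : Lp^T = Lp.
(** [LeE] and [LppE] come from applying the Laplacian to [e_i = e_i p] and [p = p p]. [JtE] is the
    [i]-th derivative of the flow equation [d_t X = w - b J], with [G^kl d_k d_l e_i - b^k d_k e_i]
    collected into [Le i]. *)
Hypothesis LeE : forall i,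
  Le i = row i J *m Lp + Le i *m p
    + contr G (fun k l => row i (E k) *m P l) *+ 2.
Hypothesis LppE : Lp = Lp *m p + p *m Lp + contr G (fun k l => P k *m P l) *+ 2.
Hypothesis JtE : forall i,
  row i Jt = Le i + contr (dG i) (fun k l => row l (E k)) - c i *m J.
Hypothesis dGE : forall i,
  dG i = - (G *m (E i *m J^T + J *m (E i)^T) *m G).

Variable pt : 'M[F]_n.
Hypothesis ptE : pt = dp Jt.
Let f1 : 'M[F]_n := contr G (fun k l => P k *m P l) *+ 2
        - contr G (fun k l => P k *m p *m P l) *+ 4.

(** Right multiplication of [LeE] by [N] isolates [e_i Lp]. Then [JtE] trades the Laplacian of [e_i]
    for its time derivative, and the derivative of the inverse metric cancels the normal-valued part
    of the contraction. *)
Let JiLp i : row i J *m Lp = row i Jt *m N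
  - contr G (fun k l => row i (A k) *m (E l)^T *m G *m J) *+ 2.
Proof.
have /(canRL (addrK _)) : row i J *m Lp
    + contr G (fun k l => row i (E k) *m P l) *+ 2 = Le i *m N.
  by apply/eqP; rewrite NE mulmxBr mulmx1 eq_sym subr_eq addrAC -LeE.
move=> ->.
have -> : Le i *m N = row i Jt *m N - contr (dG i) (fun k l => row l (A k)).
  rewrite JtE mulmxBl -[c i *m J *m N]mulmxA JN mulmx0 subr0 mulmxDl contr_mulr.
  rewrite (@eq_contr _ _ _ _ _ _ (fun k l => row l (A k))) ?addrK// => k l.
  by rewrite row_mul.
rewrite -!addrA; congr (_ + _).
have -> : contr (dG i) (fun k l => row l (A k)) =
    - contr G (fun k l => row k (E i *m J^T) *m G *m A l) *+ 2.
  have -> := dGE i; have -> : J *m (E i)^T = (E i *m J^T)^T.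
    by rewrite trmx_mul trmxK.
  by rewrite contrNl contr_sym_double// contr_sandwich// mulNrn.
rewrite mulNrn opprK.
(* [P l] has a tangent-valued and a normal-valued summand; the second gives exactly what the
   derivative of the inverse metric produced. *)
have -> : contr G (fun k l => row i (E k) *m P l) =
    contr G (fun k l => row i (A k) *m (E l)^T *m G *m J) +
    contr G (fun k l => row k (E i *m J^T) *m G *m A l).
  rewrite -contrD; apply: eq_contr => k l; rewrite PE mulmxDr !mulmxA.
  congr (_ + _).
    by rewrite row_mul.
  by rewrite Es row_mul.
by rewrite mulrnDl opprD addrCA subrr addr0.
Qed.

Lemma projection_evolution : pt = Lp + f1.
Proof.
have s1 : (contr G (fun k l => P k *m P l))^T = contr G (fun k l => P k *m P l).
  rewrite contr_tr contr_swap Gs.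
  by apply: eq_contr => k l; rewrite trmx_mul !PE !dps.
have s2 : (contr G (fun k l => P k *m p *m P l))^T =
    contr G (fun k l => P k *m p *m P l).
  rewrite contr_tr contr_swap Gs.
  by apply: eq_contr => k l; rewrite !trmx_mul !PE !dps ps mulmxA.
have f1s : f1^T = f1.
  by rewrite /f1 linearB /= !linearMn /= s1 s2.
(* The defect: once [J *m M = 0], symmetry leaves only its block [N *m M *m N]. *)
pose M := pt - Lp - f1.
have Ms : M^T = M by rewrite /M linearB linearB /= f1s LpT ptE dps.
have JM : J *m M = 0.
  apply/row_matrixP => i; rewrite row0 row_mul /M mulmxBr mulmxBr JiLp.
  have -> : row i J *m pt = row i Jt *m N by rewrite -!row_mul ptE Jdp.
  have -> : row i J *m f1 =
      contr G (fun k l => row i (A k) *m (E l)^T *m G *m J) *+ 2.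
    rewrite /f1 mulmxBr !mulmxMnr !contr_mull.
    (* [e_i P_k] is normal, so a factor [p] after it gives zero. *)
    rewrite (_ : contr G (fun k l => _ *m (P k *m p *m P l)) = 0); last first.
      rewrite -[RHS](contr0 _ _ G); apply: eq_contr => k l.
      by rewrite PE !mulmxA -row_mul Jdp -row_mul -mulmxA Np mulmx0 row0 mul0mx.
    rewrite mul0rn subr0; congr (_ *+ 2); apply: eq_contr => k l.
    rewrite !PE mulmxA -[row i J *m _]row_mul Jdp mulmxDr !mulmxA.
    rewrite -[X in _ + X *m G *m _ *m N]row_mul.
    rewrite -[E k *m N *m _]mulmxA NJ mulmx0.
    by rewrite row0 !mul0mx addr0 -row_mul -[E k *m N *m N]mulmxA NN.
  by rewrite subKr subrr.
have pM : p *m M = 0 by rewrite pE -mulmxA JM mulmx0.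
have Mp : M *m p = 0 by rewrite -ps -Ms -trmx_mul pM trmx0.
have NM : N *m M = M by rewrite NE mulmxBl mul1mx pM subr0.
have MN : M *m N = M by rewrite NE mulmxBr mulmx1 Mp subr0.
pose S := contr G (fun k l => P k *m P l).
have Npt : N *m pt *m N = 0 by rewrite ptE -mulmxA dpN mulmxA Np mul0mx.
have NLp : N *m Lp *m N = N *m S *m N *+ 2.
  rewrite LppE mulmxDr mulmxDr mulmxDl mulmxDl.
  rewrite !mulmxA Np !mul0mx addr0 -[N *m Lp *m p *m N]mulmxA pN mulmx0 add0r.
  by rewrite mulmxMnr mulmxMnl.
have Nf1 : N *m f1 *m N = - (N *m S *m N *+ 2).
  rewrite /f1 mulmxBr mulmxBl !mulmxMnr !mulmxMnl.
  rewrite -/S.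
  (* Since [P_l N = p P_l], inserting [p] between [P_k] and [P_l] changes nothing here, and
     [2 - 4 = -2]. *)
  rewrite (_ : N *m contr G (fun k l => P k *m p *m P l) *m N = N *m S *m N).
    by rewrite (mulrnDr _ 2 2) opprD addrA subrr sub0r.
  rewrite !contr_mull !contr_mulr; apply: eq_contr => k l.
  by rewrite !PE -!mulmxA dpN [p *m (p *m _)]mulmxA pp.
have M0 : M = 0.
  rewrite -MN -NM /M mulmxBr mulmxBr mulmxBl mulmxBl.
  by rewrite Npt NLp Nf1 sub0r opprK addNr.
by move/eqP: M0; rewrite /M -addrA -opprD subr_eq0 => /eqP.
Qed.

Variables (wt w Ht LH S : 'rV[F]_n) (b : 'rV[F]_m) (Gt : 'M[F]_m).
Hypotheses (wp : w *m p = b *m J) (Hp : H *m p = 0).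
Hypothesis Hkp : forall k, row k Jt *m p + H *m P k = 0.
Hypothesis Htp : Ht *m p + H *m pt = 0.
Hypothesis LHp :
  LH *m p + H *m Lp + contr G (fun k l => row k Jt *m P l) *+ 2 = 0.
Hypothesis HkJ : forall k, row k Jt *m J^T + H *m (E k)^T = 0.
Hypothesis HtE : Ht = wt - wt *m p - w *m pt.
Hypothesis LHE : LH = S - b *m Jt.
Hypothesis wtE : wt = contr Gt (fun k l => row l (E k)) + S.
Hypothesis GtE : Gt = - (G *m (Jt *m J^T + J *m Jt^T) *m G).

Let f2 : 'rV[F]_n := contr G (fun k l => row k Jt *m P l) *+ 2
        + contr G (fun k l => H *m P k *m P l) *+ 4.

Lemma curvature_evolution : Ht = LH + f2.
Proof.
have HN : H *m N = H by rewrite NE mulmxBr mulmx1 Hp subr0.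
have HJ : H *m J^T = 0 by rewrite -pJ mulmxA Hp mul0mx.
have HPk k : H *m P k = H *m (E k)^T *m G *m J.
  by rewrite PE mulmxDr !mulmxA HN HJ !mul0mx addr0.
have HPkp k : H *m P k *m p = H *m P k by rewrite HPk -!mulmxA Jp.
have HkpE k : row k Jt *m p = - (H *m P k).
  by apply/eqP; rewrite -addr_eq0; apply/eqP; exact: Hkp.
(* [f2 = 2 C + 4 B], where [B] is normal and the normal part of [C] is [-B]. So [f2] has tangential
   part [2 (C + B)] and normal part [2 B]. *)
pose B := contr G (fun k l => H *m P k *m P l).
pose C := contr G (fun k l => row k Jt *m P l).
have Bp : B *m p = 0.
  rewrite contr_mulr -[RHS](contr0 _ _ G); apply: eq_contr => k l.
  by rewrite -HPkp PE -!mulmxA [p *m _]mulmxA (PE l) pdpp !mulmx0.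
have CN : C *m N = - B.
  rewrite contr_mulr -contrN; apply: eq_contr => k l.
  by rewrite -mulmxA (PE l) dpN -(PE l) mulmxA HkpE mulNmx.
have BN : B *m N = B by rewrite NE mulmxBr mulmx1 Bp subr0.
have Cp : C *m p = C + B.
  by rewrite -[B]opprK -CN NE mulmxBr mulmx1 opprB addrC subrK.
have Hf1 : H *m f1 = - (B *+ 2).
  rewrite /f1 mulmxBr !mulmxMnr !contr_mull.
  have -> : contr G (fun k l => H *m (P k *m P l)) = B.
    by apply: eq_contr => k l; rewrite mulmxA.
  have -> : contr G (fun k l => H *m (P k *m p *m P l)) = B.
    by apply: eq_contr => k l; rewrite !mulmxA HPkp.
  by rewrite (mulrnDr _ 2 2) opprD addrA subrr sub0r.
have f2E : f2 = C *+ 2 + B *+ 4 by [].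
(* Subtracting [LHp] from [Htp] leaves [-H (pt - Lp) + 2 C], and [pt - Lp = f1] by the equation for
   the projection. *)
have tang : (Ht - LH) *m p = f2 *m p.
  rewrite f2E mulmxBl mulmxDl !mulmxMnl Cp Bp mul0rn addr0.
  have /eqP := Htp; rewrite addr_eq0 => /eqP ->.
  have /eqP := LHp; rewrite -addrA addr_eq0 => /eqP ->.
  rewrite projection_evolution mulmxDr Hf1 -/C opprD !opprK.
  by rewrite [- _ + _]addrC addrA addrNK addrC mulrnDl.
have norm : (Ht - LH) *m N = f2 *m N.
  rewrite f2E mulmxBl mulmxDl !mulmxMnl CN BN.
  (* [w pt N = (w p) pt = b J pt = b Jt N], which cancels against the same term of [LHE]. *)
  have -> : Ht *m N = wt *m N - b *m Jt *m N.
    rewrite HtE mulmxBl mulmxBl -[wt *m p *m N]mulmxA pN mulmx0 subr0.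
    by rewrite -[w *m pt *m N]mulmxA ptE dpN mulmxA wp -mulmxA Jdp mulmxA.
  rewrite LHE mulmxBl opprB addrA addrNK wtE mulmxDl addrK contr_mulr.
  rewrite (@eq_contr _ _ _ _ _ _ (fun k l => row l (A k))); last first.
    by move=> k l; rewrite row_mul.
  have JJt : J *m Jt^T = (Jt *m J^T)^T by rewrite trmx_mul trmxK.
  rewrite GtE JJt contrNl contr_sym_double// contr_sandwich//.
  (* [HkJ] moves the derivative from [H] to the frame, at the cost of a sign, and this rebuilds
     [H P_k P_l]. *)
  rewrite (_ : contr G _ = - B); last first.
    rewrite -contrN; apply: eq_contr => k l.
    have /eqP := HkJ k; rewrite addr_eq0 row_mul => /eqP ->.
    by rewrite HPk !mulNmx -[X in _ = - X]mulmxA (PE l) Jdp mulmxA.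
  by rewrite (mulrnDr _ 2 2) mulNrn addrA addNr add0r opprK.
suff : Ht - LH = f2 by move/eqP; rewrite subr_eq addrC => /eqP.
rewrite -[RHS]mulmx1 -[LHS]mulmx1.
have -> : 1%:M = p + N by rewrite NE addrC subrK.
by rewrite !mulmxDr tang norm.
Qed.

End EvolutionAlgebra.

(** * Immersions depending on a parameter *)

Section MovingImmersion.
Context {R : realType} {V : normedModType R} {m n : nat}.
Variables (W : set V) (e : 'I_m -> V) (Y : V -> 'rV[R]_n).

(** Only the directions [e i] serve as coordinate directions; what remains of [V] is a parameter,
    later the time. *)
Definition frame z : 'M[R]_(m, n) := \matrix_(i, a) mxderive (e i) Y z 0 a.

Definition ginv z : 'M[R]_m := invmx (frame z *m (frame z)^T).

Definition tproj z : 'M[R]_n := (frame z)^T *m ginv z *m frame z.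

Definition hess_trace z : 'rV[R]_n :=
  contr (ginv z) (fun k l => mxderive (e k) (mxderive (e l) Y) z).

(* [b^i = g^kl Gamma_kl^i], the coordinates of the tangential part of
   [hess_trace]. *)
Definition christoffel z : 'rV[R]_m := hess_trace z *m (frame z)^T *m ginv z.

(** The mean curvature vector: by linearity, the normal projection may be taken after the
    contraction. *)
Definition curv z : 'rV[R]_n := hess_trace z - hess_trace z *m tproj z.

(** The coordinate form [g^kl (d_k d_l - Gamma_kl^i d_i)] of the Laplace-Beltrami operator, entry by
    entry; [laplace_beltrami_slice] compares it with the divergence of the gradient. *)
Definition lapl {p q} (M : V -> 'M[R]_(p, q)) z : 'M[R]_(p, q) :=
  contr (ginv z) (fun k l => mxderive (e k) (mxderive (e l) M) z)
  - \sum_k christoffel z 0 k *: mxderive (e k) M z.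

Hypotheses (oW : open W) (sY : smooth_mx W Y).
Hypothesis uW : forall z, W z -> frame z *m (frame z)^T \in unitmx.

Let sD {p q} {M : V -> 'M[R]_(p, q)} v :
  smooth_mx W M -> smooth_mx W (mxderive v M).
Proof. exact: smooth_mxderive. Qed.

Lemma row_frame z i : row i (frame z) = mxderive (e i) Y z.
Proof. by apply/rowP => a; rewrite !mxE. Qed.

Lemma smooth_frame : smooth_mx W frame.
Proof.
move=> i a; apply: smooth_eq (sD (e i) sY 0 a) => // z Wz.
by rewrite mxE.
Qed.

Lemma smooth_ginv : smooth_mx W ginv.
Proof.
apply: smooth_mx_inv => //; apply: smooth_mx_mul => //.
  exact: smooth_frame.
by apply: smooth_mx_tr; exact: smooth_frame.
Qed.

Lemma smooth_tproj : smooth_mx W tproj.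
Proof.
have sT := smooth_mx_tr smooth_frame.
exact: (smooth_mx_mul oW (smooth_mx_mul oW sT smooth_ginv) smooth_frame).
Qed.

Lemma smooth_contr p q (f : 'I_m -> 'I_m -> V -> 'M[R]_(p, q))
    (G : V -> 'M[R]_m) :
  smooth_mx W G -> (forall k l, smooth_mx W (f k l)) ->
  smooth_mx W (fun z => contr (G z) (fun k l => f k l z)).
Proof.
move=> sG sf; apply: smooth_mx_sum => // k; apply: smooth_mx_sum => // l.
by apply: smooth_mx_scale => //; exact: sG.
Qed.

Lemma smooth_hess_trace : smooth_mx W hess_trace.
Proof. by apply: smooth_contr => [|k l]; [exact: smooth_ginv|exact/sD/sD]. Qed.

Lemma smooth_christoffel : smooth_mx W christoffel.
Proof.
have sT := smooth_mx_tr smooth_frame.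
exact: (smooth_mx_mul oW (smooth_mx_mul oW smooth_hess_trace sT) smooth_ginv).
Qed.

Lemma smooth_curv : smooth_mx W curv.
Proof.
apply: (smooth_mx_sub oW smooth_hess_trace).
exact: (smooth_mx_mul oW smooth_hess_trace smooth_tproj).
Qed.

Lemma ginv_sym z : (ginv z)^T = ginv z.
Proof. by rewrite trmx_inv trmx_mul trmxK. Qed.

Lemma frame_ginv z : W z -> frame z *m (frame z)^T *m ginv z = 1%:M.
Proof. by move=> Wz; rewrite mulmxV ?uW. Qed.

Lemma frame_tproj z : W z -> frame z *m tproj z = frame z.
Proof. by move=> Wz; rewrite /tproj !mulmxA frame_ginv// mul1mx. Qed.

Lemma tproj_sym z : (tproj z)^T = tproj z.
Proof. by rewrite /tproj !trmx_mul trmxK ginv_sym mulmxA. Qed.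

Lemma tproj_idem z : W z -> tproj z *m tproj z = tproj z.
Proof. by move=> Wz; rewrite {1}/tproj -mulmxA frame_tproj. Qed.

Lemma curv_tproj z : W z -> curv z *m tproj z = 0.
Proof. by move=> Wz; rewrite /curv mulmxBl -mulmxA tproj_idem// subrr. Qed.

Lemma curv_frame z : W z -> curv z *m (frame z)^T = 0.
Proof.
move=> Wz; have -> : (frame z)^T = tproj z *m (frame z)^T.
  by rewrite -[in RHS]tproj_sym -trmx_mul frame_tproj.
by rewrite mulmxA curv_tproj// mul0mx.
Qed.

Lemma hess_trace_tproj z : hess_trace z *m tproj z = christoffel z *m frame z.
Proof. by rewrite /christoffel /tproj !mulmxA. Qed.

Lemma derive_frame z v i :
  W z -> row i (mxderive v frame z) = mxderive v (mxderive (e i) Y) z.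
Proof.
move=> Wz; rewrite -(mxderive_row _ Wz _ smooth_frame).
by apply: (mxderive_eq oW v Wz) => y _; rewrite row_frame.
Qed.

Lemma derive_frame_sym z k i :
  W z -> row i (mxderive (e k) frame z) = row k (mxderive (e i) frame z).
Proof.
move=> Wz; rewrite (derive_frame (e k) i Wz) (derive_frame (e i) k Wz).
exact: (mxderive_comm oW (e k) (e i) sY Wz).
Qed.

Lemma derive_ginv z v : W z -> mxderive v ginv z =
  - (ginv z *m (mxderive v frame z *m (frame z)^T
                + frame z *m (mxderive v frame z)^T) *m ginv z).
Proof.
move=> Wz; have sJ := smooth_frame; have sT := smooth_mx_tr sJ.
rewrite (mxderiveV oW v Wz uW (smooth_mx_mul oW sJ sT)).
by rewrite (mxderiveM oW v Wz sJ sT) (mxderive_tr v Wz sJ).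
Qed.

Lemma derive_tproj z v : W z -> mxderive v tproj z =
  (1%:M - tproj z) *m (mxderive v frame z)^T *m ginv z *m frame z
  + (frame z)^T *m ginv z *m mxderive v frame z *m (1%:M - tproj z).
Proof.
move=> Wz; have sJ := smooth_frame; have sT := smooth_mx_tr sJ.
rewrite -(projection_variation (derive_ginv v Wz)).
rewrite (mxderiveM oW v Wz (smooth_mx_mul oW sT smooth_ginv) sJ).
rewrite (mxderiveM oW v Wz sT smooth_ginv) (mxderive_tr v Wz sJ).
by rewrite mulmxDl.
Qed.

Lemma derive_contr p q (f : 'I_m -> 'I_m -> V -> 'M[R]_(p, q))
    (G : V -> 'M[R]_m) z v :
  W z -> smooth_mx W G -> (forall k l, smooth_mx W (f k l)) ->
  mxderive v (fun z => contr (G z) (fun k l => f k l z)) z =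
  contr (mxderive v G z) (fun k l => f k l z)
  + contr (G z) (fun k l => mxderive v (f k l) z).
Proof.
move=> Wz sG sf.
have sGf k l : smooth_mx W (fun z => G z k l *: f k l z).
  by apply: smooth_mx_scale => //; exact: sG.
have sGs k := smooth_mx_sum oW (index_enum _) (sGf k).
rewrite (mxderive_sum v Wz sGs).
rewrite /contr -big_split; apply: eq_bigr => k _.
rewrite (mxderive_sum v Wz (sGf k)) -big_split; apply: eq_bigr => l _.
by rewrite (mxderive_scale oW v Wz (sG k l) (sf k l)) -(mxderiveE v k l sG Wz).
Qed.

Lemma lapl_eq p q (M N : V -> 'M[R]_(p, q)) z :
  W z -> (forall y, W y -> M y = N y) -> lapl M z = lapl N z.
Proof.
move=> Wz MN.
have D1 k y : W y -> mxderive (e k) M y = mxderive (e k) N y.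
  by move=> Wy; exact: (mxderive_eq oW (e k) Wy MN).
have D2 k l :
    mxderive (e k) (mxderive (e l) M) z = mxderive (e k) (mxderive (e l) N) z.
  apply: (mxderive_eq oW (e k) Wz).
  exact: D1.
rewrite /lapl (eq_contr _ D2).
rewrite (eq_bigr (fun k => christoffel z 0 k *: mxderive (e k) N z)) // => k _.
by rewrite (D1 k z Wz).
Qed.

Lemma lapl_tr p q (M : V -> 'M[R]_(p, q)) z : W z -> smooth_mx W M ->
  lapl (fun y => (M y)^T) z = (lapl M z)^T.
Proof.
move=> Wz sM.
have D1 k y :
    W y -> mxderive (e k) (fun y => (M y)^T) y = (mxderive (e k) M y)^T.
  by move=> Wy; rewrite (mxderive_tr (e k) Wy sM).
rewrite /lapl linearB /= contr_tr (raddf_sum trmx).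
rewrite (eq_bigr (fun k => (christoffel z 0 k *: mxderive (e k) M z)^T))
    => [|k _].
  rewrite (@eq_contr _ _ _ _ _ _
    (fun k l => (mxderive (e k) (mxderive (e l) M) z)^T)) // => k l.
  rewrite -(mxderive_tr _ Wz (sD _ sM)).
  exact: (mxderive_eq oW (e k) Wz (D1 l)).
by rewrite D1//; apply/matrixP => i j; rewrite !mxE.
Qed.

Lemma lapl_cst p q (A : 'M[R]_(p, q)) z : W z -> lapl (cst A) z = 0.
Proof.
move=> Wz; have D0 v : mxderive v (cst A : V -> _) = cst 0.
  by apply/funext => y; rewrite mxderive_cst.
rewrite /lapl big1 => [|k _]; last by rewrite D0 scaler0.
rewrite subr0 -[RHS](contr0 _ _ (ginv z)); apply: eq_contr => k l.
by rewrite D0 mxderive_cst.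
Qed.

(** The two mixed terms of the second-order product rule agree after exchanging [k] and [l], by
    symmetry of the inverse metric; the first-order part is a derivation. *)
Lemma lapl_mul p q r (M : V -> 'M[R]_(p, q)) (N : V -> 'M[R]_(q, r)) z :
  W z -> smooth_mx W M -> smooth_mx W N ->
  lapl (fun y => M y *m N y) z = M z *m lapl N z + lapl M z *m N z
    + contr (ginv z) (fun k l => mxderive (e k) M z *m mxderive (e l) N z) *+ 2.
Proof.
move=> Wz sM sN.
rewrite /lapl.
have -> : contr (ginv z)
    (fun k l => mxderive (e k) (mxderive (e l) (fun y => M y *m N y)) z) =
   M z *m contr (ginv z) (fun k l => mxderive (e k) (mxderive (e l) N) z)
   + contr (ginv z) (fun k l => mxderive (e k) (mxderive (e l) M) z) *m N z
   + contr (ginv z) (fun k l => mxderive (e k) M z *m mxderive (e l) N z) *+ 2.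
  rewrite mulr2n [X in _ + _ + (_ + X)]contr_swap ginv_sym.
  rewrite contr_mull contr_mulr -!contrD.
  apply: eq_contr => k l.
  rewrite (@mxderive_eq _ _ _ oW _ _ _
    (fun y => mxderive (e l) M y *m N y + M y *m mxderive (e l) N y) _ _ Wz);
    last first.
    by move=> y Wy; exact: (mxderiveM oW _ Wy sM sN).
  rewrite (mxderiveD _ Wz (smooth_mx_mul oW (sD _ sM) sN)
    (smooth_mx_mul oW sM (sD _ sN))).
  rewrite (mxderiveM oW _ Wz (sD _ sM) sN) (mxderiveM oW _ Wz sM (sD _ sN)).
  by rewrite [X in _ + X = _]addrC addrACA [X in X + _ = _]addrC
    [X in _ + X = _]addrC.
have -> : \sum_k christoffel z 0 k *: mxderive (e k) (fun y => M y *m N y) z =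
   M z *m (\sum_k christoffel z 0 k *: mxderive (e k) N z) +
   (\sum_k christoffel z 0 k *: mxderive (e k) M z) *m N z.
  rewrite mulmx_sumr mulmx_suml -big_split; apply: eq_bigr => k _.
  by rewrite (mxderiveM oW _ Wz sM sN) scalerDr addrC -scalemxAr -scalemxAl.
rewrite mulmxBr mulmxBl.
by rewrite opprD addrAC [X in X + _ = _]addrACA.
Qed.

(** * Evolution equations at a point of the flow *)

Section Flow.
Variables (tau : V) (z : V) (Wz : W z).
(** The flow equation is required at [z] only after one or two differentiations in the directions
    [e k], which a single time slice can supply. *)
Hypothesis flow1 : forall k,
  mxderive (e k) (mxderive tau Y) z = mxderive (e k) curv z.
Hypothesis flow2 : forall k l,
  mxderive (e k) (mxderive (e l) (mxderive tau Y)) z =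
  mxderive (e k) (mxderive (e l) curv) z.

Let D1 := mxderive_eq oW.

Let gs : (ginv z)^T = ginv z. Proof. exact: ginv_sym. Qed.
Let gG := frame_ginv Wz.
Let Es i k := derive_frame_sym k i Wz.

Let lapl_tproj_sym : (lapl tproj z)^T = lapl tproj z.
Proof.
rewrite -(lapl_tr Wz smooth_tproj).
by apply: lapl_eq => // y _; rewrite tproj_sym.
Qed.

Let lapl_tangent i : lapl (mxderive (e i) Y) z =
  row i (frame z) *m lapl tproj z + lapl (mxderive (e i) Y) z *m tproj z
  + contr (ginv z) (fun k l => row i (mxderive (e k) frame z) *m
                               mxderive (e l) tproj z) *+ 2.
Proof.
have se := sD (e i) sY.
rewrite [LHS](lapl_eq (N := fun y => mxderive (e i) Y y *m tproj y) Wz);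
  last first.
  by move=> y Wy; rewrite -row_frame -row_mul frame_tproj.
rewrite (lapl_mul Wz se smooth_tproj) row_frame.
congr (_ + _ *+ 2); apply: eq_contr => k l.
by rewrite derive_frame.
Qed.

Let lapl_tproj : lapl tproj z =
  lapl tproj z *m tproj z + tproj z *m lapl tproj z
  + contr (ginv z)
      (fun k l => mxderive (e k) tproj z *m mxderive (e l) tproj z) *+ 2.
Proof.
rewrite [LHS](lapl_eq (N := fun y => tproj y *m tproj y) Wz); last first.
  by move=> y Wy; rewrite tproj_idem.
by rewrite (lapl_mul Wz smooth_tproj smooth_tproj) [X in X + _]addrC.
Qed.

Let row_dframe i : row i (mxderive tau frame z) = mxderive (e i) curv z.
Proof.
by rewrite derive_frame// -flow1 (mxderive_comm oW tau (e i) sY Wz).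
Qed.

(** The derivative along [v] is commuted to the innermost place, where [v = tau] meets the flow
    equation and [v = e i] gives a tangent vector. *)
Let derive_hess_trace v : mxderive v hess_trace z =
  contr (mxderive v ginv z) (fun k l => row l (mxderive (e k) frame z)) +
  contr (ginv z) (fun k l => mxderive (e k) (mxderive (e l) (mxderive v Y)) z).
Proof.
rewrite (derive_contr v Wz smooth_ginv (fun k l => sD (e k) (sD (e l) sY))).
congr (_ + _); apply: eq_contr => k l; first by rewrite derive_frame.
rewrite (mxderive_comm oW v (e k) (sD (e l) sY) Wz).
apply: (D1 (e k) Wz) => y Wy.
exact: (mxderive_comm oW v (e l) sY Wy).
Qed.

Let derive_curv i : row i (mxderive tau frame z) =
  lapl (mxderive (e i) Y) z
  + contr (mxderive (e i) ginv z) (fun k l => row l (mxderive (e k) frame z))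
  - mxderive (e i) christoffel z *m frame z.
Proof.
rewrite row_dframe.
have sC := smooth_mx_mul oW smooth_christoffel smooth_frame.
rewrite (D1 (N := fun y => hess_trace y - christoffel y *m frame y) (e i) Wz);
  last by move=> y _; rewrite -hess_trace_tproj.
rewrite (mxderiveB (e i) Wz smooth_hess_trace sC).
rewrite (mxderiveM oW (e i) Wz smooth_christoffel smooth_frame).
rewrite derive_hess_trace /lapl [christoffel z *m _]mulmx_sum_row.
(* [b^k d_i e_k = b^k d_k e_i] is the first-order part of the Laplacian of [e_i]. *)
rewrite (eq_bigr
    (fun k => christoffel z 0 k *: mxderive (e k) (mxderive (e i) Y) z));
  last by move=> k _; rewrite -derive_frame// Es.
rewrite opprD [X in _ + X = _]addrC addrA.
by rewrite -[X in X - _ = _]addrA [X in X - _ = _]addrC.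
Qed.

Lemma derive_tproj_flow : mxderive tau tproj z = lapl tproj z +
  (contr (ginv z)
    (fun k l => mxderive (e k) tproj z *m mxderive (e l) tproj z) *+ 2
  - contr (ginv z) (fun k l => mxderive (e k) tproj z *m tproj z
                               *m mxderive (e l) tproj z) *+ 4).
Proof.
exact: (projection_evolution gs gG Es erefl erefl
  (fun k => derive_tproj (e k) Wz) lapl_tproj_sym lapl_tangent lapl_tproj
  derive_curv
  (fun i => derive_ginv (e i) Wz) (derive_tproj tau Wz)).
Qed.

Lemma derive_curv_flow : mxderive tau curv z = lapl curv z +
  (contr (ginv z)
    (fun k l => mxderive (e k) curv z *m mxderive (e l) tproj z) *+ 2
  + contr (ginv z) (fun k l => curv z *m mxderive (e k) tproj z
                               *m mxderive (e l) tproj z) *+ 4).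
Proof.
have sp := smooth_tproj; have sc := smooth_curv; have sh := smooth_hess_trace.
have sJT := smooth_mx_tr smooth_frame.
have Hp v : mxderive v curv z *m tproj z + curv z *m mxderive v tproj z = 0.
  rewrite -(mxderiveM oW v Wz sc sp) (D1 (N := cst 0) v Wz) ?mxderive_cst//.
  by move=> y Wy; rewrite curv_tproj.
have HJ k : row k (mxderive tau frame z) *m (frame z)^T
    + curv z *m (mxderive (e k) frame z)^T = 0.
  rewrite row_dframe -(mxderive_tr (e k) Wz smooth_frame).
  rewrite -(mxderiveM oW (e k) Wz sc sJT).
  rewrite (D1 (N := cst 0) (e k) Wz) ?mxderive_cst//.
  by move=> y Wy; rewrite curv_frame.
have Hkp k : row k (mxderive tau frame z) *m tproj z
    + curv z *m mxderive (e k) tproj z = 0 by rewrite row_dframe.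
have LHp : lapl curv z *m tproj z + curv z *m lapl tproj z +
    contr (ginv z) (fun k l => row k (mxderive tau frame z) *m
                               mxderive (e l) tproj z) *+ 2 = 0.
  rewrite (eq_contr _
    (h := fun k l => mxderive (e k) curv z *m mxderive (e l) tproj z));
    last by move=> k l; rewrite row_dframe.
  rewrite [X in X + _]addrC -(lapl_mul Wz sc sp).
  rewrite (lapl_eq (N := cst 0) Wz) ?lapl_cst//.
  by move=> y Wy; rewrite curv_tproj.
have HtE : mxderive tau curv z = mxderive tau hess_trace z
    - mxderive tau hess_trace z *m tproj z
    - hess_trace z *m mxderive tau tproj z.
  rewrite (mxderiveB tau Wz sh (smooth_mx_mul oW sh sp)).
  by rewrite (mxderiveM oW tau Wz sh sp) opprD addrA.
pose S := contr (ginv z) (fun k l => mxderive (e k) (mxderive (e l) curv) z).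
have LHE : lapl curv z = S - christoffel z *m mxderive tau frame z.
  rewrite /lapl mulmx_sum_row; congr (_ - _); apply: eq_bigr => k _.
  by rewrite row_dframe.
(* The second derivatives of the flow equation enter here, through [g^kl d_k d_l d_t Y]. *)
have wtE : mxderive tau hess_trace z =
    contr (mxderive tau ginv z) (fun k l => row l (mxderive (e k) frame z)) + S.
  rewrite derive_hess_trace; congr (_ + _).
  by apply: eq_contr => k l; exact: flow2.
rewrite (curvature_evolution gs gG Es erefl erefl
  (fun k => derive_tproj (e k) Wz) lapl_tproj_sym lapl_tangent lapl_tproj
  derive_curv
  (fun i => derive_ginv (e i) Wz) (derive_tproj tau Wz)
  (hess_trace_tproj z) (curv_tproj Wz) Hkp (Hp tau) LHp HJ HtE LHE wtE
  (derive_ginv tau Wz)).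
congr (_ + (_ *+ 2 + _)); apply: eq_contr => k l.
by rewrite row_dframe.
Qed.

End Flow.

End MovingImmersion.

(** * Time slices *)

Section TimeSlice.
Context {R : realType} {m n : nat}.
Local Notation E := ('rV[R]_m * R)%type.

Definition space_dir (k : 'I_m) : E := (delta_mx 0 k, 0).

Variables (W : set E) (Y : E -> 'rV[R]_n) (s : R).
Hypothesis oW : open W.

Definition slice_domain : set 'rV[R]_m := [set u | W (u, s)].

Lemma slice_domain_open : open slice_domain.
Proof.
rewrite openE => u Wu; rewrite /interior.
have c : {for u, continuous (fun u : 'rV[R]_m => (u, s))}.
  apply: differentiable_continuous.
  apply: differentiable_pair; first exact: (@ex_diff _ _ _ _ _ id).
  exact: differentiable_cst.
have : nbhs (u, s) W by exact: open_nbhs_nbhs.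
by move=> /c.
Qed.

Lemma partial_slice {B : normedModType R} (f : 'rV[R]_m -> B) (h : E -> B) u k :
  W (u, s) -> (forall u, W (u, s) -> f u = h (u, s)) ->
  partial k f u = 'D_(space_dir k) h (u, s).
Proof.
move=> Wu fh.
rewrite /partial (near_eq_derive _ (open_near_eq slice_domain_open Wu fh)).
rewrite /derive; suff -> : (fun r : R => r^-1 *:
    (h (r *: delta_mx 0 k + u, s) - h (u, s))) =
  (fun r => r^-1 *: (h (r *: space_dir k + (u, s)) - h (u, s))) by [].
apply/funext => r.
rewrite -[r *: space_dir k + _]/(r *: delta_mx 0 k + u, r *: 0 + s).
by rewrite scaler0 add0r.
Qed.

Lemma partial_slice_mx p q (f : 'rV[R]_m -> 'M[R]_(p, q))
    (h : E -> 'M[R]_(p, q)) u k :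
  W (u, s) -> (forall u, W (u, s) -> f u = h (u, s)) ->
  partial k f u = mxderive (space_dir k) h (u, s).
Proof. by move=> Wu fh; rewrite mxderive.unlock; exact: partial_slice. Qed.

(** Difference quotients along [space_dir k] stay at time [s], so an identity on a single slice
    suffices. This is how the flow equation gets differentiated. *)
Lemma mxderive_slice_eq p q (f h : E -> 'M[R]_(p, q)) u k :
  W (u, s) -> (forall u, W (u, s) -> f (u, s) = h (u, s)) ->
  mxderive (space_dir k) f (u, s) = mxderive (space_dir k) h (u, s).
Proof.
move=> Wu fh; rewrite -(@partial_slice_mx _ _ (fun u => f (u, s)))//.
exact: partial_slice_mx.
Qed.

Hypothesis sY : smooth_mx W Y.
Local Notation frame := (frame space_dir Y).
Local Notation ginv := (ginv space_dir Y).
Local Notation tproj := (tproj space_dir Y).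
Local Notation curv := (curv space_dir Y).
Local Notation lapl := (lapl space_dir Y).
Hypothesis uW : forall z, W z -> frame z *m (frame z)^T \in unitmx.

Variable psi : 'rV[R]_m -> 'rV[R]_n.
Hypothesis psiE : forall u, W (u, s) -> psi u = Y (u, s).

Lemma contrE p q (G : 'M[R]_m) (f : 'I_m -> 'I_m -> 'M[R]_(p, q)) a b :
  contr G f a b = \sum_k \sum_l G k l * f k l a b.
Proof.
rewrite summxE; apply: eq_bigr => k _; rewrite summxE; apply: eq_bigr => l _.
by rewrite mxE.
Qed.

Lemma dotE d (x y : 'rV[R]_d) : dot x y = (x *m y^T) 0 0.
Proof. by rewrite mxE; apply: eq_bigr => a _; rewrite mxE. Qed.

Lemma partial_param u k : W (u, s) -> partial k psi u = row k (frame (u, s)).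
Proof. by move=> Wu; rewrite row_frame (partial_slice_mx k Wu psiE). Qed.

Lemma metric_slice u :
  W (u, s) -> metric psi u = frame (u, s) *m (frame (u, s))^T.
Proof.
move=> Wu; apply/matrixP => i j; rewrite mxE dotE !partial_param//.
by rewrite !mxE; apply: eq_bigr => a _; rewrite !mxE.
Qed.

Lemma inv_metric_slice u : W (u, s) -> inv_metric psi u = ginv (u, s).
Proof. by move=> Wu; rewrite /inv_metric metric_slice. Qed.

Lemma tangent_proj_slice u : W (u, s) -> tangent_proj psi u = tproj (u, s).
Proof.
move=> Wu; apply/matrixP => a b; rewrite mxE /tproj inv_metric_slice//.
rewrite -mulmxA mxE; apply: eq_bigr => i _.
rewrite !mxE mulr_sumr; apply: eq_bigr => j _.
by rewrite !partial_param// !mxE; ring.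
Qed.

Lemma mean_curvature_slice u : W (u, s) -> mean_curvature psi u = curv (u, s).
Proof.
move=> Wu; rewrite /mean_curvature /curv /hess_trace contr_mulr -contrN -contrD.
rewrite inv_metric_slice//.
apply: eq_bigr => k _; apply: eq_bigr => l _.
rewrite /second_fund tangent_proj_slice//.
rewrite (@partial_slice_mx _ _ _ (mxderive (space_dir l) Y) u k)// => u' Wu'.
exact: partial_slice_mx.
Qed.

(** The differential of [f] as a row of coordinate components, so that the tangential gradient is
    [df G J]. *)
Definition dgrad (f : E -> R) z : 'rV[R]_m := \row_k 'D_(space_dir k) f z.

Lemma smooth_dgrad f : smooth_open W f -> smooth_mx W (dgrad f).
Proof.
move=> sf i k; apply: smooth_eq (smooth_derive (space_dir k) sf) => // z _.
by rewrite mxE.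
Qed.

Section Scalar.
Variables (f : 'rV[R]_m -> R) (h : E -> R).
Hypotheses (fh : forall u, W (u, s) -> f u = h (u, s)) (sh : smooth_open W h).

Lemma tgrad_slice u : W (u, s) ->
  tgrad psi f u = dgrad h (u, s) *m ginv (u, s) *m frame (u, s).
Proof.
move=> Wu; rewrite /tgrad exchange_big mulmx_sum_row; apply: eq_bigr => j _.
rewrite -scaler_suml partial_param//; congr (_ *: _).
rewrite mxE; apply: eq_bigr => i _.
by rewrite inv_metric_slice// (partial_slice i Wu fh) !mxE mulrC.
Qed.

End Scalar.

(** For gradients of the form [df G J], the middle product [G J J^T G] collapses to [G]. *)
Lemma tgrad_dot (f g : 'rV[R]_m -> R) (h l : E -> R) u : W (u, s) ->
  (forall u, W (u, s) -> f u = h (u, s)) ->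
  (forall u, W (u, s) -> g u = l (u, s)) ->
  dot (tgrad psi f u) (tgrad psi g u) =
  \sum_i \sum_j ginv (u, s) i j *
     ('D_(space_dir i) h (u, s) * 'D_(space_dir j) l (u, s)).
Proof.
move=> Wu fh gl; rewrite dotE (tgrad_slice fh Wu) (tgrad_slice gl Wu).
rewrite !trmx_mul ginv_sym !mulmxA.
have fG := frame_ginv uW Wu.
rewrite -[_ *m frame (u, s) *m _]mulmxA -[_ *m (frame (u, s) *m _) *m _]mulmxA.
rewrite fG mulmx1 mxE exchange_big; apply: eq_bigr => j _.
rewrite !mxE mulr_suml; apply: eq_bigr => i _.
by rewrite !mxE; ring.
Qed.

(** The divergence of [w = dh G J] is the sum over [k] of the [k]-th entries of [d_k w J^T G]. In
    the product rule [J J^T G = 1], and the derivatives of [G] and of the last factor [J] combine to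
    [-w (d_k J)^T G], which yields the Christoffel term. *)
Lemma laplace_beltrami_slice f h u : W (u, s) ->
  (forall u, W (u, s) -> f u = h (u, s)) -> smooth_open W h ->
  laplace_beltrami psi f u =
  \sum_k \sum_l ginv (u, s) k l * 'D_(space_dir k) ('D_(space_dir l) h) (u, s)
  - \sum_k christoffel space_dir Y (u, s) 0 k * 'D_(space_dir k) h (u, s).
Proof.
move=> Wu fh sh.
have sq := smooth_dgrad sh; have sG := smooth_ginv oW sY uW.
have sJ : smooth_mx W frame by exact: smooth_frame.
pose w z := dgrad h z *m ginv z *m frame z.
have sqG := smooth_mx_mul oW sq sG.
have sw : smooth_mx W w := smooth_mx_mul oW sqG sJ.
set z := (u, s) in Wu *.
have -> : laplace_beltrami psi f u =
    \sum_k (mxderive (space_dir k) w z *m (frame z)^T *m ginv z) 0 k.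
  rewrite /laplace_beltrami /tdiv.
  under eq_bigr => a _.
    rewrite (@tgrad_slice _ (fun z => w z 0 a) _ u)//; last first.
      by move=> u' Wu'; rewrite (tgrad_slice fh Wu').
    rewrite -mulmxA mxE; over.
  rewrite exchange_big; apply: eq_bigr => k _.
  rewrite -mulmxA mxE; apply: eq_bigr => a _.
  rewrite [dgrad _ _ _ _]mxE -(mxderiveE _ _ _ sw Wu); congr (_ * _).
  have -> : (frame z)^T *m ginv z = (ginv z *m frame z)^T.
    by rewrite trmx_mul ginv_sym.
  by rewrite [RHS]mxE.
have E1 k : mxderive (space_dir k) w z *m (frame z)^T *m ginv z =
    mxderive (space_dir k) (dgrad h) z *m ginv z
    - dgrad h z *m ginv z *m frame z *m
       (mxderive (space_dir k) frame z)^T *m ginv z.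
  rewrite (mxderiveM oW _ Wu sqG sJ) (mxderiveM oW _ Wu sq sG).
  have fG := frame_ginv uW Wu.
  rewrite (derive_ginv oW sY uW _ Wu) !mulmxDl.
  rewrite -!mulmxA ![frame z *m _]mulmxA !fG.
  rewrite !mulmx1 mulmxN mulmxDl !mulmxDr opprD -!mulmxA.
  by rewrite [X in _ + X + _]addrC !addrA addrNK.
under eq_bigr do rewrite E1 mxE [X in _ + X]mxE.
rewrite big_split sumrN /=; congr (_ - _).
  apply: eq_bigr => k _; rewrite mxE; apply: eq_bigr => l _.
  rewrite (mxderiveE _ _ _ sq Wu) mulrC -[in LHS](ginv_sym space_dir Y) mxE.
  by under eq_fun do rewrite mxE.
set x := dgrad h z *m ginv z *m frame z.
(* The gradient is tangential, so pairing it with [g^kl d_k d_l Y] sees only the tangential part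
   [b^k e_k]. *)
have -> : \sum_k christoffel space_dir Y z 0 k * 'D_(space_dir k) h z =
    (x *m (hess_trace space_dir Y z)^T) 0 0.
  have -> : x *m (hess_trace space_dir Y z)^T =
      dgrad h z *m (christoffel space_dir Y z)^T.
    by rewrite /christoffel !trmx_mul trmxK ginv_sym /x !mulmxA.
  by rewrite mxE; apply: eq_bigr => k _; rewrite !mxE mulrC.
rewrite /hess_trace contr_tr contr_mull summxE; apply: eq_bigr => k _.
rewrite summxE mxE; apply: eq_bigr => l _.
rewrite [RHS]mxE mulrC -[in LHS](ginv_sym space_dir Y) mxE; congr (_ * _).
rewrite -(derive_frame space_dir oW sY _ _ Wu) !mxE.
by apply: eq_bigr => a _; rewrite !mxE.
Qed.

Lemma laplace_beltrami_slice_mx p q (f : 'rV[R]_m -> R) (M : E -> 'M[R]_(p, q))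
    a b u : W (u, s) -> smooth_mx W M ->
  (forall u, W (u, s) -> f u = M (u, s) a b) ->
  laplace_beltrami psi f u = lapl M (u, s) a b.
Proof.
move=> Wu sM fM.
rewrite (@laplace_beltrami_slice f (fun z => M z a b) u)//.
rewrite /lapl /contr !mxE !summxE; congr (_ - _); apply: eq_bigr => k _.
  rewrite summxE; apply: eq_bigr => l _; rewrite [RHS]mxE; congr (_ * _).
  rewrite (mxderiveE _ _ _ (smooth_mxderive oW (space_dir l) sM) Wu).
  apply: near_eq_derive; apply: (open_near_eq oW Wu) => y Wy.
  by rewrite (mxderiveE _ _ _ sM Wy).
by rewrite [RHS]mxE (mxderiveE _ _ _ sM Wu).
Qed.

Lemma mxderive_tproj_sym u k : W (u, s) ->
  (mxderive (space_dir k) tproj (u, s))^T = mxderive (space_dir k) tproj (u, s).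
Proof.
move=> Wu; have sp : smooth_mx W tproj by exact: smooth_tproj.
rewrite -(mxderive_tr _ Wu sp); apply: (mxderive_eq oW _ Wu) => y _.
by rewrite tproj_sym.
Qed.

(** Because the derivatives of the projection are symmetric, the sums over [mu] and [ka] become
    matrix products. *)
Lemma f1_slice (P : 'rV[R]_m -> 'M[R]_n) u a b : W (u, s) ->
  (forall u, W (u, s) -> P u = tproj (u, s)) ->
  f1 psi P u a b =
  (contr (ginv (u, s)) (fun k l => mxderive (space_dir k) tproj (u, s)
                                *m mxderive (space_dir l) tproj (u, s)) *+ 2
  - contr (ginv (u, s)) (fun k l => mxderive (space_dir k) tproj (u, s)
      *m tproj (u, s) *m mxderive (space_dir l) tproj (u, s)) *+ 4) a b.
Proof.
move=> Wu PE; have sp : smooth_mx W tproj by exact: smooth_tproj.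
set z := (u, s) in Wu *.
pose d k := mxderive (space_dir k) tproj z.
have D c mu k : 'D_(space_dir k) (fun z => tproj z c mu) z = d k c mu.
  by rewrite /d (mxderiveE _ _ _ sp Wu).
have ds k mu c : d k c mu = d k mu c.
  by rewrite -[in RHS](mxderive_tproj_sym k Wu : (d k)^T = d k) [RHS]mxE.
have T c mu c' mu' : dot (tgrad psi (fun u => P u c mu) u)
      (tgrad psi (fun u => P u c' mu') u) =
    \sum_k \sum_l ginv z k l * (d k c mu * d l c' mu').
  rewrite (@tgrad_dot _ _ (fun z => tproj z c mu) (fun z => tproj z c' mu'))//;
    try by move=> u' Wu'; rewrite PE.
  by apply: eq_bigr => k _; apply: eq_bigr => l _; rewrite !D.
rewrite [RHS]mxE [X in _ = _ + X]mxE !mulmxnE !contrE /f1 !mulr_natl PE//.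
congr (_ *+ _ - _ *+ _).
  under eq_bigr do rewrite T.
  rewrite exchange_big; apply: eq_bigr => k _ /=.
  rewrite exchange_big; apply: eq_bigr => l _ /=.
  rewrite -mulr_sumr mxE; congr (_ * _); apply: eq_bigr => mu _.
  by rewrite [d l b mu]ds.
under eq_bigr do under eq_bigr do rewrite T.
have F k l : (d k *m tproj z *m d l) a b =
    \sum_mu \sum_ka tproj z mu ka * (d k a mu * d l b ka).
  rewrite mxE exchange_big; apply: eq_bigr => ka _; rewrite mxE mulr_suml.
  by apply: eq_bigr => mu _; rewrite [d l b ka]ds mulrCA mulrA.
under [RHS]eq_bigr do under eq_bigr do rewrite F.
(* The sums over the coordinate indices are brought outside those over [mu] and [ka]. *)
under eq_bigr => mu _.
  under eq_bigr => ka _.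
    rewrite mulr_sumr; under eq_bigr do rewrite mulr_sumr.
    over.
  rewrite exchange_big /=; under eq_bigr do rewrite exchange_big /=.
  over.
rewrite exchange_big; apply: eq_bigr => k _ /=.
rewrite exchange_big; apply: eq_bigr => l _ /=.
rewrite mulr_sumr; apply: eq_bigr => mu _; rewrite mulr_sumr.
by apply: eq_bigr => ka _; rewrite mulrCA.
Qed.

(** Besides the symmetry of the derivatives of the projection, this exchanges [k] and [l]: the row
    vector must stand on the left of the matrix product. *)
Lemma f2_slice (P : 'rV[R]_m -> 'M[R]_n) (H : 'rV[R]_m -> 'rV[R]_n) u a :
  W (u, s) ->
  (forall u, W (u, s) -> P u = tproj (u, s)) ->
  (forall u, W (u, s) -> H u = curv (u, s)) ->
  f2 psi P H u a =
  (contr (ginv (u, s)) (fun k l => mxderive (space_dir k) curv (u, s)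
                                *m mxderive (space_dir l) tproj (u, s)) *+ 2
  + contr (ginv (u, s)) (fun k l => curv (u, s)
       *m mxderive (space_dir k) tproj (u, s)
       *m mxderive (space_dir l) tproj (u, s)) *+ 4) 0 a.
Proof.
move=> Wu PE HE; have sp : smooth_mx W tproj by exact: smooth_tproj.
have sc : smooth_mx W curv by exact: smooth_curv.
set z := (u, s) in Wu *.
pose d k := mxderive (space_dir k) tproj z.
pose c k := mxderive (space_dir k) curv z.
have D x mu k : 'D_(space_dir k) (fun z => tproj z x mu) z = d k x mu.
  by rewrite /d (mxderiveE _ _ _ sp Wu).
have C mu k : 'D_(space_dir k) (fun z => curv z 0 mu) z = c k 0 mu.
  by rewrite /c (mxderiveE _ _ _ sc Wu).
have ds k mu x : d k x mu = d k mu x.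
  by rewrite -[in RHS](mxderive_tproj_sym k Wu : (d k)^T = d k) [RHS]mxE.
have T mu : dot (tgrad psi (fun u => P u a mu) u)
      (tgrad psi (fun u => H u 0 mu) u) =
    \sum_k \sum_l ginv z k l * (d k a mu * c l 0 mu).
  rewrite (@tgrad_dot _ _ (fun z => tproj z a mu) (fun z => curv z 0 mu))//;
    try by move=> u' Wu'; rewrite ?PE ?HE.
  by apply: eq_bigr => k _; apply: eq_bigr => l _; rewrite D C.
have T' mu ka :
    dot (tgrad psi (fun u => P u a mu) u) (tgrad psi (fun u => P u mu ka) u) =
    \sum_k \sum_l ginv z k l * (d k a mu * d l mu ka).
  rewrite (@tgrad_dot _ _ (fun z => tproj z a mu) (fun z => tproj z mu ka))//;
    try by move=> u' Wu'; rewrite PE.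
  by apply: eq_bigr => k _; apply: eq_bigr => l _; rewrite !D.
rewrite [RHS]mxE !mulmxnE /f2 !mulr_natl HE//; congr (_ *+ _ + _ *+ _).
  under eq_bigr do rewrite T.
  rewrite contr_swap ginv_sym contrE.
  rewrite exchange_big; apply: eq_bigr => k _ /=.
  rewrite exchange_big; apply: eq_bigr => l _ /=.
  rewrite -mulr_sumr mxE; congr (_ * _); apply: eq_bigr => mu _.
  by rewrite [d k a mu]ds mulrC.
under eq_bigr do under eq_bigr do rewrite T'.
rewrite contr_swap ginv_sym contrE.
have F k l : (curv z *m d l *m d k) 0 a =
    \sum_mu \sum_ka d k a mu * d l mu ka * curv z 0 ka.
  rewrite mxE; apply: eq_bigr => mu _; rewrite mxE mulr_suml.
  by apply: eq_bigr => ka _; rewrite [d k a mu]ds [d l mu ka]ds; ring.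
under [RHS]eq_bigr do under eq_bigr do rewrite F.
under eq_bigr => mu _.
  under eq_bigr => ka _.
    rewrite mulr_suml; under eq_bigr do rewrite mulr_suml.
    over.
  rewrite exchange_big /=; under eq_bigr do rewrite exchange_big /=.
  over.
rewrite exchange_big; apply: eq_bigr => k _ /=.
rewrite exchange_big; apply: eq_bigr => l _ /=.
rewrite mulr_sumr; apply: eq_bigr => mu _; rewrite mulr_sumr.
by apply: eq_bigr => ka _; rewrite !mulrA.
Qed.

End TimeSlice.

(** * Time derivatives on [0, T] *)

Section TimeDerivative.
Context {R : realType}.

(** [x J J^T = 0] gives [|x J|^2 = 0], a vanishing sum of squares, hence [x = 0] by full rank. *)
Lemma gram_unit m n (J : 'M[R]_(m, n)) : row_free J -> J *m J^T \in unitmx.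
Proof.
move=> Jf; rewrite -row_free_unit -kermx_eq0; apply/eqP/row_matrixP => i.
rewrite row0; set x := row i _.
have xJJ : x *m (J *m J^T) = 0 by rewrite -row_mul mulmx_ker row0.
have xJ0 : x *m J = 0.
  have : (x *m J *m (x *m J)^T) 0 0 = 0.
    by rewrite trmx_mul mulmxA -[x *m J *m J^T]mulmxA xJJ mul0mx mxE.
  rewrite mxE => /eqP; rewrite psumr_eq0 => [/allP h|a _]; last first.
    by rewrite [_^T _ _]mxE -expr2 sqr_ge0.
  apply/rowP => a; have := h a (mem_index_enum a).
  by rewrite [_^T _ _]mxE -expr2 sqrf_eq0 => /eqP ->; rewrite mxE.
by have := row_free_inj Jf; apply; rewrite xJ0 mul0mx.
Qed.

(** The end points are limit points of the interval too; this makes one-sided time derivatives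
    unique. *)
Lemma within_itv_proper (T t : R) : 0 < T -> t \in `[0, T] ->
  ProperFilter (within `[0, T] t^').
Proof.
move=> T0; rewrite in_itv /= => /andP[t0 tT].
apply: Build_ProperFilter_ex => P [e /= e0 eP].
(* [e / 2] stays inside the ball; [T / 2] leaves room for a step towards the farther end point. *)
pose d := Num.min (e / 2) (T / 2).
have e2 : 0 < e / 2 by rewrite divr_gt0.
have T2 : 0 < T / 2 by rewrite divr_gt0.
have d0 : 0 < d by rewrite lt_min e2.
have de : d < e by rewrite gt_min ltr_pdivrMr// ltr_pMr// ltr1n.
have dT : d <= T / 2 by rewrite ge_min lexx orbT.
have [tT2|tT2] := leP t (T / 2).
  exists (t + d); apply: eP => /=.
  - by rewrite opprD addrA subrr sub0r normrN gtr0_norm.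
  - by rewrite gt_eqF// ltrDl.
  - rewrite in_itv /=; apply/andP; split; first by rewrite addr_ge0// ltW.
    by rewrite [T]splitr lerD.
exists (t - d); apply: eP => /=.
- by rewrite opprB addrCA subrr addr0 gtr0_norm.
- by rewrite lt_eqF// gtrBl.
- rewrite in_itv /= subr_ge0 (le_trans dT (ltW tT2))/=.
  by rewrite (le_trans _ tT)// gerBl ltW.
Qed.

Definition time_dir {m : nat} : 'rV[R]_m * R := (0, 1).

(** The derivative along [[0, T]], one-sided at its ends, is read off from the two-sided derivative
    of an extension [h] that agrees with [c] on [[0, T]] near [t]. *)
Lemma has_time_deriv_slice {m : nat} {B : normedModType R}
    (h : 'rV[R]_m * R -> B) (c : R -> B) (T t : R) u :
  t \in `[0, T] -> derivable h (u, t) time_dir ->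
  (\forall s \near t, s \in `[0, T] -> c s = h (u, s)) ->
  has_time_deriv T c t ('D_time_dir h (u, t)).
Proof.
move=> tT dh ch; rewrite /has_time_deriv.
have ct : c t = h (u, t) by exact: (nbhs_singleton ch tT).
move=> A /dh [e /= e0 eA].
have near_t : \forall s \near t, ball t e s by exact: nbhsx_ballx.
have : \forall s \near t, s != t -> s \in `[0, T] ->
    A ((s - t)^-1 *: (c s - c t)).
  apply: filterS2 ch near_t => s cs ts st sT; rewrite cs// ct.
  have -> : (u, s) = (s - t) *: time_dir + (u, t).
    rewrite -[RHS]/((s - t) *: 0 + u, (s - t) *: 1 + t).
    by rewrite scaler0 add0r [_ *: 1]mulr1 subrK.
  apply: eA; rewrite ?subr_eq0//.
  by rewrite /= sub0r normrN distrC.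
by [].
Qed.

Lemma has_time_deriv_unique {B : normedModType R} (c : R -> B) (T t : R) l l' :
  0 < T -> t \in `[0, T] -> has_time_deriv T c t l -> has_time_deriv T c t l' ->
  l = l'.
Proof.
move=> T0 tT cl cl'; have := within_itv_proper T0 tT => PF.
exact: (cvg_unique _ cl cl').
Qed.

End TimeDerivative.

(** * The evolution equations along the flow *)

Theorem lemma2p1 (R : realType) (m n : nat) (T : R)
  (Gamma0 : set 'rV[R]_n)
  (X : 'rV[R]_n -> R -> 'rV[R]_n)
  (v : 'rV[R]_n -> R -> 'rV[R]_n)
  (hm : (1 <= m <= 3)%N) (hmn : (1 <= n - m)%N) (hT : 0 < T)
  (hGamma0 : closed_submanifold m Gamma0)
  (hXsmooth : smooth_on (Gamma0 `*` `[0, T]) (fun z : 'rV[R]_n * R => X z.1 z.2))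
  (hXemb : forall t : R, t \in `[0, T] -> embedding m Gamma0 (X ^~ t))
  (hX0 : forall p, Gamma0 p -> X p 0 = p)
  (hv : forall p (t : R), Gamma0 p -> t \in `[0, T] ->
     has_time_deriv T (X p) t (v (X p t) t))
  (hMCF : forall (U : set 'rV[R]_m) (phi : 'rV[R]_m -> 'rV[R]_n),
     local_param Gamma0 U phi ->
     forall u (t : R), U u -> t \in `[0, T] ->
       v (X (phi u) t) t = mean_curvature (slice X phi t) u)
  (U : set 'rV[R]_m) (phi : 'rV[R]_m -> 'rV[R]_n)
  (hphi : local_param Gamma0 U phi)
  (P : 'rV[R]_n -> R -> 'M[R]_n) (H : 'rV[R]_n -> R -> 'rV[R]_n)
  (hP : forall u (t : R), U u -> t \in `[0, T] ->
     P (X (phi u) t) t = tangent_proj (slice X phi t) u)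
  (hH : forall u (t : R), U u -> t \in `[0, T] ->
     H (X (phi u) t) t = mean_curvature (slice X phi t) u)
  (u : 'rV[R]_m) (t : R) (hu : U u) (ht : t \in `[0, T]) :
  (forall a b : 'I_n,
     has_material_deriv T X (fun x s => P x s a b) (phi u) t
       (laplace_beltrami (slice X phi t)
          (pullback X phi (fun x s => P x s a b) t) u
        + f1 (slice X phi t) (pullback X phi P t) u a b))
  /\
  (forall a : 'I_n,
     has_material_deriv T X (fun x s => H x s 0 a) (phi u) t
       (laplace_beltrami (slice X phi t)
          (pullback X phi (fun x s => H x s 0 a) t) u
        + f2 (slice X phi t) (pullback X phi P t) (pullback X phi H t) u a)).
Proof.
have [oU sphi _ _ [Om [_ imOm]]] := hphi.
have phiG u' : U u' -> Gamma0 (phi u').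
  move=> Uu'; have : (phi @` U) (phi u') by exists u'.
  by rewrite imOm => -[].
(* Smoothness up to the ends of [[0, T]] provides a smooth extension [F] of [X] around [(phi u, t)],
   for which two-sided time derivatives exist. *)
have [Q [F [oQ Qut sF FE]]] : exists (Q : set ('rV[R]_n * R)%type) F,
    [/\ open Q, Q (phi u, t), smooth_open Q F &
      forall y, Q y -> (Gamma0 `*` `[0, T]) y -> F y = X y.1 y.2].
  by apply: hXsmooth; split; [exact: phiG|exact: ht].
pose W0 := lift_domain U phi Q.
have oW0 : open W0 by exact: lift_domain_open.
pose Y z := F (lift_space phi z).
have sY0 : smooth_mx W0 Y.
  move=> i a; rewrite ord1; have sFa := smooth_entry a oQ sF.
  exact: (smooth_lift oU sphi oQ sFa).
have YE s u' : s \in `[0, T] -> W0 (u', s) -> slice X phi s u' = Y (u', s).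
  by move=> sT [Uu' Ou']; rewrite /Y FE//; split => //; exact: phiG.
pose Jac := frame space_dir Y.
pose gram z := \det (Jac z *m (Jac z)^T).
have sJ0 : smooth_mx W0 Jac by exact: smooth_frame.
have sgram : smooth_open W0 gram.
  exact: (smooth_mx_det oW0 (smooth_mx_mul oW0 sJ0 (smooth_mx_tr sJ0))).
(* The extension may fail to be an immersion at times outside [[0, T]], so the domain is cut down to
   the open set where the Gram determinant does not vanish. *)
pose W : set ('rV[R]_m * R)%type := [set z | W0 z /\ gram z != 0].
have WW0 z : W z -> W0 z by case.
have oW : open W.
  rewrite openE => z [W0z gz]; rewrite /interior.
  have n0 : nbhs z W0 by exact: open_nbhs_nbhs.
  have ng : \forall y \near z, gram y != 0.
    exact: (cvgr_neq0 _ (smooth_cts sgram W0z) gz).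
  exact: filterS2 (fun z W0z gz => conj W0z gz) n0 ng.
have sY : smooth_mx W Y by move=> i a k; exact: Ck_sub WW0 (sY0 i a k).
have uW z : W z -> Jac z *m (Jac z)^T \in unitmx.
  by move=> [_]; rewrite unitmxE unitfE.
have Wut : W (u, t).
  have W0ut : W0 (u, t) by split.
  split=> //; rewrite /gram -unitfE -unitmxE; apply: gram_unit.
  have := (hXemb t ht).1 U phi hphi u hu.
  congr (is_true (row_free _)); apply/matrixP => i a; rewrite !mxE.
  by rewrite (partial_slice_mx oW0 i W0ut (fun u' => YE t u' ht)).
have psiE s u' : s \in `[0, T] -> W (u', s) -> slice X phi s u' = Y (u', s).
  by move=> sT /WW0; exact: YE.
have tprojE s u' : s \in `[0, T] -> W (u', s) ->
    P (X (phi u') s) s = tproj space_dir Y (u', s).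
  move=> sT Wu'; rewrite hP//; last by have [[]] := Wu'.
  exact: (tangent_proj_slice oW (fun u => psiE s u sT) Wu').
have curvE s u' : s \in `[0, T] -> W (u', s) ->
    H (X (phi u') s) s = curv space_dir Y (u', s).
  move=> sT Wu'; rewrite hH//; last by have [[]] := Wu'.
  exact: (mean_curvature_slice oW (fun u => psiE s u sT) Wu').
have nearW u' : W (u', t) -> \forall s \near t, W (u', s).
  move=> Wu'; have c : {for t, continuous (fun s => (u', s))}.
    apply: differentiable_continuous; apply: differentiable_pair.
      exact: differentiable_cst.
    exact: (@ex_diff _ _ _ _ _ id).
  by have /c : nbhs (u', t) W by exact: open_nbhs_nbhs.
(* Both sides are the time derivative along [[0, T]] of [X (phi u')] at [t], and such limits are
   unique. Having this for all [u'] in the slice allows differentiation in space. *)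
have flow u' :
    W (u', t) -> mxderive time_dir Y (u', t) = curv space_dir Y (u', t).
  move=> Wu'; have Uu' : U u' by have [[]] := Wu'.
  have := hv (phi u') t (phiG _ Uu') ht; rewrite (hMCF U phi hphi)//.
  rewrite (mean_curvature_slice oW (fun u => psiE t u ht) Wu') => vt.
  rewrite mxderive.unlock; apply: (has_time_deriv_unique hT ht _ vt).
  apply: (has_time_deriv_slice ht); first exact: (smooth_mx_derivable sY Wu').
  apply: filterS (nearW _ Wu') => s Wu's sT; exact: psiE.
have flow1 k : mxderive (space_dir k) (mxderive time_dir Y) (u, t) =
    mxderive (space_dir k) (curv space_dir Y) (u, t).
  exact: (mxderive_slice_eq oW k Wut flow).
have flow2 k l :
    mxderive (space_dir k) (mxderive (space_dir l) (mxderive time_dir Y)) (u, t) =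
    mxderive (space_dir k) (mxderive (space_dir l) (curv space_dir Y)) (u, t).
  apply: (mxderive_slice_eq oW k Wut) => u' Wu'.
  exact: (mxderive_slice_eq oW l Wu' flow).
have st : smooth_mx W (tproj space_dir Y) by exact: smooth_tproj.
have sc : smooth_mx W (curv space_dir Y) by exact: smooth_curv.
have psit := fun u => psiE t u ht.
have Pt u' (Wu' : W (u', t)) := tprojE t u' ht Wu'.
have Ht u' (Wu' : W (u', t)) := curvE t u' ht Wu'.
split=> [a b|a].
  (* It suffices to recognize the right-hand side as the two-sided time derivative of the projection
     built from the extension, which then restricts to [[0, T]]. *)
  have -> : laplace_beltrami (slice X phi t)
        (pullback X phi (fun x s => P x s a b) t) u
      + f1 (slice X phi t) (pullback X phi P t) u a b =
      'D_time_dir (fun z => tproj space_dir Y z a b) (u, t).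
    rewrite -(mxderiveE _ _ _ st Wut).
    rewrite (derive_tproj_flow oW sY uW Wut flow1) mxE.
    rewrite -(f1_slice oW sY uW psit a b Wut Pt); congr (_ + _).
    apply: (laplace_beltrami_slice_mx oW sY uW psit Wut st) => u' Wu'.
    by rewrite -Pt.
  apply: (has_time_deriv_slice ht).
    exact: (smooth_derivable (st a b) Wut).
  by apply: filterS (nearW _ Wut) => s Wus sT; rewrite tprojE.
have -> : laplace_beltrami (slice X phi t)
      (pullback X phi (fun x s => H x s 0 a) t) u
    + f2 (slice X phi t) (pullback X phi P t) (pullback X phi H t) u a =
    'D_time_dir (fun z => curv space_dir Y z 0 a) (u, t).
  rewrite -(mxderiveE _ _ _ sc Wut).
  rewrite (derive_curv_flow oW sY uW Wut flow1 flow2) mxE.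
  rewrite -(f2_slice oW sY uW psit a Wut Pt Ht); congr (_ + _).
  apply: (laplace_beltrami_slice_mx oW sY uW psit Wut sc) => u' Wu'.
  by rewrite -Ht.
apply: (has_time_deriv_slice ht); first exact: (smooth_derivable (sc 0 a) Wut).
by apply: filterS (nearW _ Wut) => s Wus sT; rewrite curvE.
Qed.
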